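(* Let $\varepsilon=\varepsilon(n,m)\in(0,1/100)$, $1\le p<q\le\infty$, and $\gamma=\gamma(n,m)\ge1$. Then there is a dimension- and rank-preserving $2^{\varepsilon m}$-time reduction from $\gamma'$-$\mathsf{CVP}_p$ to $\gamma$-$\mathsf{CVP}_q$, where \[\gamma':=\frac{100\log^{1/p}(1/\varepsilon)}{\varepsilon^{1/p}}\cdot\gamma.\]
   Context: A lattice of rank $n$ in $\mathbb{R}^m$ is the set of integer combinations of $n$ linearly independent vectors (a basis) in $\mathbb{R}^m$. $\|\cdot\|_p$ is the $\ell_p$ norm ($\|\mathbf{x}\|_\infty=\max_i|x_i|$). $\mathrm{dist}_p(\mathbf{t},\mathcal{L})=\min_{\mathbf{x}\in\mathcal{L}}\|\mathbf{x}-\mathbf{t}\|_p$. $\gamma$-$\mathsf{CVP}_p$: given a basis of $\mathcal{L}\subset\mathbb{R}^m$ and $\mathbf{t}\in\mathbb{R}^m$, output $\mathbf{v}\in\mathcal{L}$ with $\|\mathbf{v}-\mathbf{t}\|_p\le\gamma\,\mathrm{dist}_p(\mathbf{t},\mathcal{L})$. A $T$-time reduction from A to B is a (randomized) algorithm running in time $T$ solving A using an oracle for B; dimension- and rank-preserving means the oracle is called only on lattices of the same dimension and rank as the input.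
   Formalization: Bases and targets are rational, the time is 2^{εm} times a fixed polynomial in the input bit length (2^{εm} alone cannot cover reading the input), log is base 2, and the algorithm may read binary digits of p, 1/q, ε(n,m) and γ(n,m) at a cost of the number of digits. *)

(* Defs.v *)
From Stdlib Require List.
From mathcomp Require Import all_boot all_order all_algebra.
From mathcomp Require Import boolp classical_sets reals ereal exp.

Set Implicit Arguments.
Unset Strict Implicit.
Unset Printing Implicit Defensive.

Import Order.TTheory GRing.Theory Num.Theory.
Local Open Scope ring_scope.

Section Lattices.
Variable R : realType.

(* Only exponents in [1, +oo] are meaningful; -oo gets a junk value. *)
Definition lpnorm (p : \bar R) m (x : 'rV[R]_m) : R :=
  match p with
  | r%:E => (\sum_j `|x ord0 j| `^ r) `^ r^-1
  | +oo%E => \big[Num.max/0]_j `|x ord0 j|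
  | -oo%E => 0
  end.

(* The basis vectors are the rows of B. *)
Definition lattice n m (B : 'M[R]_(n, m)) : set 'rV[R]_m :=
  [set x | exists z : 'rV[int]_n, x = map_mx intr z *m B]%classic.

(* For a lattice (a closed discrete set) this infimum is a minimum. *)
Definition dist (p : \bar R) m (t : 'rV[R]_m) (L : set 'rV[R]_m) : R :=
  inf [set lpnorm p (x - t) | x in L]%classic.

Definition log2 (x : R) : R := ln x / ln 2.

End Lattices.

(* Machine inputs are rational; norms are nevertheless taken in R. *)
Record instance := Instance {
  rk : nat;
  dm : nat;
  basis : 'M[rat]_(rk, dm);
  target : 'rV[rat]_dm }.

Definition valid (I : instance) : Prop := row_free (basis I).

Definition problem := forall I : instance, 'rV[rat]_(dm I) -> Prop.

Definition CVP (R : realType) (g : nat -> nat -> R) (p : \bar R) : problem :=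
  fun I v =>
    let L := lattice (map_mx ratr (basis I)) in
    let t := map_mx ratr (target I) in
    let v' := map_mx ratr v in
    L v' /\ lpnorm p (v' - t) <= g (rk I) (dm I) * dist p t L.

Definition oracle := forall I : instance, 'rV[rat]_(dm I).

Definition solves (O : oracle) (B : problem) : Prop :=
  forall I, valid I -> B I (O I).

(* Randomized oracle random-access machines under the logarithmic cost
    criterion.  Programs are while-programs over integer registers and integer arrays.
    Every operation is charged the bit length of the integers it handles
    (the product of the bit lengths for multiplication and division). *)

Inductive expr :=
| Const of int
| Reg of nat
| Arr of nat & expr
| Add of expr & expr
| Sub of expr & expr
| Mul of expr & expr
| Div of expr & expr.

Inductive cmd :=
| Skip
| Set_reg of nat & expr
| Set_arr of nat & expr & expr
| Seq of cmd & cmd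
| If_lt of expr & expr & cmd & cmd
| While_lt of expr & expr & cmd
| Flip of nat
| Param of nat & nat & expr
| Query.

Record state := State {
  regs : nat -> int;
  arrs : nat -> nat -> int;
  coins : seq bool;           (* random bits not consumed yet *)
  clock : nat;
  queries : seq instance }.   (* oracle calls made so far *)

Definition bitlen (z : int) : nat := (trunc_log 2 `|z|).+1.

Fixpoint eval (s : state) (e : expr) : int :=
  match e with
  | Const z => z
  | Reg x => regs s x
  | Arr a e => arrs s a `|eval s e|%N
  | Add e f => eval s e + eval s f
  | Sub e f => eval s e - eval s f
  | Mul e f => eval s e * eval s f
  | Div e f => (eval s e %/ eval s f)%Z
  end.

Local Open Scope nat_scope.

(* Naming a register or a cell costs only its address; its content is charged
   by the operation using it. *)
Fixpoint ecost (s : state) (e : expr) : nat :=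
  match e with
  | Const z => bitlen z
  | Reg _ => 1
  | Arr _ e => ecost s e + bitlen (eval s e) + 1
  | Add e f | Sub e f =>
      ecost s e + ecost s f + bitlen (eval s e) + bitlen (eval s f)
  | Mul e f | Div e f =>
      ecost s e + ecost s f + bitlen (eval s e) * bitlen (eval s f)
  end.

(* Scanning two binary numbers in parallel from their low-order bits decides
   their order by the time the shorter one is exhausted, whence the minimum:
   an over-long oracle answer can be recognized without being read in full. *)
Definition test_cost (s : state) (e f : expr) : nat :=
  ecost s e + ecost s f + minn (bitlen (eval s e)) (bitlen (eval s f)) + 1.

Local Close Scope nat_scope.

Definition set_reg (s : state) (x : nat) (v : int) : state :=
  State [eta regs s with x |-> v] (arrs s) (coins s) (clock s) (queries s).

Definition set_arr (s : state) (a : nat) (f : nat -> int) : state :=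
  State (regs s) [eta arrs s with a |-> f] (coins s) (clock s) (queries s).

Definition charge (s : state) (k : nat) : state :=
  State (regs s) (arrs s) (coins s) (clock s + k)%N (queries s).

(* Memory layout.  Both the input and every oracle query are read from
   registers 0 (rank) and 1 (dimension), arrays 0 and 1 (numerators and
   denominators of the basis, row by row) and arrays 2 and 3 (the same for the
   target).  Both the output and every oracle answer are in arrays 4 and 5. *)

Definition frac (num den : nat -> int) (k : nat) : rat :=
  (num k)%:~R / (den k)%:~R.

Definition mem_instance (s : state) : instance :=
  @Instance `|regs s 0| `|regs s 1|
    (\matrix_(i, j) frac (arrs s 0) (arrs s 1) (i * `|regs s 1| + j)%N)
    (\row_j frac (arrs s 2) (arrs s 3) j).

Definition mem_size (s : state) : nat :=
  (\sum_(k < `|regs s 0| * `|regs s 1|)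
     (bitlen (arrs s 0 k) + bitlen (arrs s 1 k)) +
  \sum_(k < `|regs s 1|) (bitlen (arrs s 2 k) + bitlen (arrs s 3 k)))%N.

Definition mem_output (s : state) m : 'rV[rat]_m :=
  \row_j frac (arrs s 4) (arrs s 5) j.

Definition entry n m (A : 'M[rat]_(n, m)) (i j : nat) : rat :=
  if (insub i, insub j) is (Some i', Some j') then A i' j' else 0.

Definition init (I : instance) (w : seq bool) : state :=
  let b k := entry (basis I) (k %/ dm I)%N (k %% dm I)%N in
  let t k := entry (target I) 0 k in
  State
    [eta (fun=> 0) with 0%N |-> (rk I)%:Z, 1%N |-> (dm I)%:Z]
    [eta (fun _ _ => 0) with
       0%N |-> fun k => numq (b k), 1%N |-> fun k => denq (b k),
       2%N |-> fun k => numq (t k), 3%N |-> fun k => denq (t k)]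
    w 0 [::].

Definition size_of (I : instance) : nat := mem_size (init I [::]).

(* The answer is delivered in lowest terms, for free. *)
Definition answer (s : state) (J : instance) (v : 'rV[rat]_(dm J)) : state :=
  let put (g : rat -> int) (f : nat -> int) k :=
    if (k < dm J)%N then g (entry v 0 k) else f k in
  let s1 := set_arr s 4 (put numq (arrs s 4)) in
  let s2 := set_arr s1 5 (put denq (arrs s1 5)) in
  State (regs s2) (arrs s2) (coins s2) (clock s2) (rcons (queries s2) J).

Section Semantics.
Variables (R : realType) (theta : nat -> R) (O : oracle).

(* [theta] lists real parameters known to the algorithm; [Param x i e] puts the
   integer part of 2^k theta_i into register x, where k is the value of e. *)
Inductive exec : cmd -> state -> state -> Prop :=
| exec_skip s : exec Skip s s
| exec_set_reg s x e :
    let v := eval s e in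
    exec (Set_reg x e) s (charge (set_reg s x v) (ecost s e + bitlen v)%N)
| exec_set_arr s a e f :
    let i := eval s e in
    let v := eval s f in
    exec (Set_arr a e f) s
      (charge (set_arr s a [eta arrs s a with `|i|%N |-> v])
              (ecost s e + ecost s f + bitlen i + bitlen v)%N)
| exec_seq c d s s' s'' :
    exec c s s' -> exec d s' s'' -> exec (Seq c d) s s''
| exec_if e f c d s s' :
    exec (if eval s e < eval s f then c else d) (charge s (test_cost s e f)) s' ->
    exec (If_lt e f c d) s s'
| exec_while_stop e f c s :
    ~~ (eval s e < eval s f) ->
    exec (While_lt e f c) s (charge s (test_cost s e f))
| exec_while_loop e f c s s' s'' :
    eval s e < eval s f ->
    exec c (charge s (test_cost s e f)) s' ->
    exec (While_lt e f c) s' s'' ->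
    exec (While_lt e f c) s s''
| exec_flip x s b w :
    coins s = b :: w ->
    exec (Flip x) s
      (charge (set_reg (State (regs s) (arrs s) w (clock s) (queries s))
                       x (b : nat)%:Z) 1)
| exec_param x i e s :
    let k := `|eval s e|%N in
    let v := Num.floor (2 ^+ k * theta i) in
    exec (Param x i e) s
      (charge (set_reg s x v) (ecost s e + k + bitlen v)%N)
| exec_query s :
    let J := mem_instance s in
    exec Query s (charge (answer s (O J)) (mem_size s + 1)%N).

End Semantics.

(* [P] solves [A] on every valid input with probability at least 2/3, given any
   oracle for [B]; the time bound and the restriction on the queries hold for
   all outcomes of the coins.  [r] is a bound on the number of coin tosses. *)
Definition dim_rank_preserving_reduction (R : realType)
    (theta : instance -> nat -> R) (T : instance -> R) (A B : problem)
    (P : cmd) : Prop :=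
  forall O : oracle, solves O B ->
  forall I : instance, valid I ->
  exists r : nat,
    let runs_to (w : r.-tuple bool) := exec (theta I) O P (init I w) in
    (forall w : r.-tuple bool, exists s : state,
       [/\ runs_to w s,
           (clock s)%:R <= T I
         & forall J, List.In J (queries s) ->
             [/\ valid J, rk J = rk I & dm J = dm I]]) /\
    2 / 3 <=
      #|[pred w : r.-tuple bool |
          `[< exists s, runs_to w s /\ A I (mem_output s (dm I)) >]]|%:R
        / 2 ^+ r :> R.

(* The real parameters are made available to the machine through their binary
   expansions, since they need not be computable; q is given by 1/q, which is 0 for q = +oo. *)
Definition parameters (R : realType) (p : R) (q : \bar R)
    (eps gamma : nat -> nat -> R) (I : instance) (i : nat) : R :=
  nth 0 [:: p; (if q is r%:E then r^-1 else 0);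
            eps (rk I) (dm I); gamma (rk I) (dm I)] i.

(* "2^(eps m) time": polynomial factors in the input length are suppressed. *)
Definition time_bound (R : realType) (eps : nat -> nat -> R) (c : nat)
    (I : instance) : R :=
  2 `^ (eps (rk I) (dm I) * (dm I)%:R) * (c * (size_of I).+1 ^ c)%:R.

(* Main.v *)
(* Scale everything to integers: with D the product of all denominators, the
   target is T / D.  Let X / D be a nearly shortest difference between a lattice
   vector and the target.  For a power g of 2, the truncation z of X / g is an
   integer vector with |X - g z| < g in every coordinate and, if g is chosen so
   that sum_j |X_j|^p is about g^p N, with sum_j |z_j| <= N.  Calling the oracle
   at (T + g z) / D gives a lattice vector within gamma m^(1/q) g of that point
   in the q-norm, hence within gamma m^(1/p) g in the p-norm, and the factor
   (m / N)^(1/p) is O((log(1/eps) / eps)^(1/p)) when N is about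
   eps m / log(1/eps).  All such z are enumerated by codes of about eps m bits:
   moving by one block of about 2/eps positions costs one bit and a unit entry
   inside the current block costs log(1/eps) + O(1) bits.  The best answer is
   selected by a score which approximates the p-th power of the p-norm within
   4 * 2^(p/2); answers with very long numerators are farther from the target
   than the zero vector and are skipped unread. *)

Require Import Defs.
From mathcomp Require Import all_boot all_order all_algebra.
From mathcomp Require Import boolp classical_sets reals ereal exp.
From mathcomp Require Import zify ring lra.

Set Implicit Arguments.
Unset Strict Implicit.
Unset Printing Implicit Defensive.

Import Order.TTheory GRing.Theory Num.Theory.
Local Open Scope ring_scope.

(** * A cost-aware weakest precondition calculus for the machine *)

Lemma bitlen_le (z : int) k : (0 < k)%N -> (`|z| < 2 ^ k)%N -> (bitlen z <= k)%N.
Proof.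
move=> k0 zk; rewrite /bitlen; case: (posnP `|z|%N) => [->|z0]; first by rewrite trunc_log0.
by rewrite -(@ltn_exp2l 2) // (leq_ltn_trans (trunc_logP _ z0)).
Qed.

Lemma ltn_exp_bitlen (z : int) : (`|z| < 2 ^ bitlen z)%N.
Proof. exact: trunc_log_ltn. Qed.

Lemma absz_divz_le (a b : int) : (`|(a %/ b)%Z| <= `|a|)%N.
Proof.
case: (eqVneq b 0) => [->|b0]; first by rewrite divz0.
have := divz_eq a b; have := modz_ge0 a b0; have := ltz_mod a b0.
move: (a %/ b)%Z (a %% b)%Z => d r; nia.
Qed.

Record memory := Memory {
  mr : nat -> int;
  ma : nat -> nat -> int;
  mq : seq instance }.

Definition setr (M : memory) x v := Memory [eta mr M with x |-> v] (ma M) (mq M).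

Definition seta (M : memory) a i v :=
  let f : nat -> int := [eta ma M a with i |-> v] in
  Memory (mr M) [eta ma M with a |-> f] (mq M).

Fixpoint ev (M : memory) (e : expr) : int :=
  match e with
  | Const z => z
  | Reg x => mr M x
  | Arr a e => ma M a `|ev M e|%N
  | Add e f => ev M e + ev M f
  | Defs.Sub e f => ev M e - ev M f
  | Mul e f => ev M e * ev M f
  | Div e f => (ev M e %/ ev M f)%Z
  end.

Fixpoint esize (e : expr) : nat :=
  match e with
  | Const _ | Reg _ => 1
  | Arr _ e => (esize e).+1
  | Add e f | Defs.Sub e f | Mul e f | Div e f => (esize e + esize f)%N
  end.

Fixpoint mod_regs (c : cmd) : seq nat :=
  match c with
  | Skip | Set_arr _ _ _ | Query => [::]
  | Set_reg x _ | Flip x | Param x _ _ => [:: x]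
  | Seq c d | If_lt _ _ c d => mod_regs c ++ mod_regs d
  | While_lt _ _ c => mod_regs c
  end.

Fixpoint mod_arrs (c : cmd) : seq nat :=
  match c with
  | Skip | Set_reg _ _ | Flip _ | Param _ _ _ => [::]
  | Set_arr a _ _ => [:: a]
  | Query => [:: 4; 5]
  | Seq c d | If_lt _ _ c d => mod_arrs c ++ mod_arrs d
  | While_lt _ _ c => mod_arrs c
  end.

Definition frame (c : cmd) (M M' : memory) : Prop :=
  (forall x, x \notin mod_regs c -> mr M' x = mr M x) /\
  (forall a, a \notin mod_arrs c -> ma M' a = ma M a).

Section Machine.
Variables (R : realType) (theta : nat -> R) (O : oracle) (w : seq bool).
Variables (y : nat) (good_query : instance -> Prop).

Definition kap : nat := ((100 * y) ^ 2 * y)%N.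

Definition st (M : memory) (t : nat) := State (mr M) (ma M) w t (mq M).

Lemma evalE M t e : Defs.eval (st M t) e = ev M e.
Proof. by elim: e => //= [a e ->|e -> f ->|e -> f ->|e -> f ->|e -> f ->]. Qed.

Lemma exec_frame c s s' : exec theta O c s s' ->
  (forall x, x \notin mod_regs c -> regs s' x = regs s x) /\
  (forall a, a \notin mod_arrs c -> arrs s' a = arrs s a).
Proof.
elim=> {c s s'} //=.
- by move=> s x e; split=> // z; rewrite inE => /negPf ->.
- by move=> s a e f; split=> // z; rewrite inE => /negPf ->.
- move=> c d s s' s'' _ [r1 a1] _ [r2 a2]; split=> x;
    rewrite mem_cat negb_or => /andP[? ?]; rewrite ?r2 ?r1 // a2 // a1 //.
- move=> e f c d s s' _; case: ifP => _ [r1 a1]; split=> x;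
    rewrite mem_cat negb_or => /andP[? ?]; rewrite ?r1 // a1 //.
- move=> e f c s s' s'' _ _ [r1 a1] _ [r2 a2]; split=> x hx; first by rewrite r2 // r1.
  by rewrite a2 // a1.
- by move=> x s b v hv; split=> // z; rewrite inE => /negPf ->.
- by move=> x i e s; split=> // z; rewrite inE => /negPf ->.
- move=> s; split=> // a; rewrite !inE negb_or => /andP[/negPf h4 /negPf h5].
  by rewrite h4 h5.
Qed.

Definition small (v : int) : bool := (`|v| < 2 ^ y)%N.

(* Array 4 is exempted because it holds oracle answers, whose length is not
   bounded a priori. *)
Definition safe (M : memory) : Prop :=
  [/\ forall x, small (mr M x),
      forall a k, a != 4%N -> small (ma M a k)
    & forall J, List.In J (mq M) -> good_query J].

Definition wp (c : cmd) (k : nat) (Q : memory -> Prop) (M : memory) : Prop :=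
  safe M -> forall t, exists M' t',
    [/\ exec theta O c (st M t) (st M' t'), (t' <= t + k * kap)%N, safe M' & Q M'].

Fixpoint readable (M : memory) (e : expr) : Prop :=
  match e with
  | Const z => (`|z| < 8)%N
  | Reg _ => True
  | Arr a e => readable M e /\
      (if a == 4%N then is_true (small (ma M a `|ev M e|%N)) else True)
  | Add e f | Defs.Sub e f | Mul e f | Div e f => readable M e /\ readable M f
  end.

Definition addressable (M : memory) (e : expr) : Prop :=
  if e is Arr _ f then readable M f else readable M e.

Hypothesis y3 : (3 <= y)%N.

Lemma ev_bound M e : safe M -> readable M e -> (`|ev M e| < 2 ^ (esize e * y))%N.
Proof.
move=> [sr sa _].
have expD a b : (2 ^ ((a + b) * y) = 2 ^ (a * y) * 2 ^ (b * y))%N by rewrite mulnDl expnD.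
have e0 f : (0 < esize f)%N by elim: f => //= *; rewrite addn_gt0; lia.
have p2 f : (2 <= 2 ^ (esize f * y))%N.
  by rewrite -{1}(expn1 2) leq_exp2l // muln_gt0 e0; lia.
elim: e => /=.
- move=> z hz; rewrite mul1n (leq_trans hz) //.
  by rewrite -[8%N]/(2 ^ 3)%N leq_exp2l.
- by move=> x _; rewrite mul1n; exact: sr.
- move=> a e _ [_ ha]; rewrite (@leq_trans (2 ^ y)) //; last by rewrite leq_exp2l // leq_pmull.
  move: ha; case: eqP => [-> //|/eqP na _]; exact: sa.
- move=> e he f hf [/he he' /hf hf']; rewrite expD.
  have := p2 e; have := p2 f; move: he' hf'; nia.
- move=> e he f hf [/he he' /hf hf']; rewrite expD.
  have := p2 e; have := p2 f; move: he' hf'; nia.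
- move=> e he f hf [/he he' /hf hf']; rewrite expD abszM.
  have := p2 e; have := p2 f; move: he' hf'; nia.
- move=> e he f hf [/he he' /hf hf']; rewrite expD.
  have := p2 e; have := p2 f; have := absz_divz_le (ev M e) (ev M f); move: he' hf'; nia.
Qed.

Lemma esize_gt0 e : (0 < esize e)%N.
Proof. by elim: e => //= *; rewrite addn_gt0; lia. Qed.

Lemma ev_bitlen M e : safe M -> readable M e -> (bitlen (ev M e) <= esize e * y)%N.
Proof.
move=> sM rM; apply: bitlen_le (ev_bound sM rM).
by rewrite muln_gt0 esize_gt0; lia.
Qed.

Lemma ecost_le M t e : safe M -> addressable M e ->
  (ecost (st M t) e <= 3 * (esize e * y) ^ 2)%N.
Proof.
move: e => e0 sM.
have key f : readable M f -> (ecost (st M t) f <= 3 * (esize f * y) ^ 2)%N.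
  elim: f => /=.
  - move=> z hz; apply: (@leq_trans y); last by nia.
    apply: bitlen_le; first by lia.
    by rewrite (leq_trans hz) // -[8%N]/(2 ^ 3)%N leq_exp2l.
  - by move=> *; nia.
  - move=> a e ih [re _]; have := ih re; rewrite evalE.
    have := ev_bitlen sM re; have := esize_gt0 e; nia.
  - move=> e ihe f ihf [re rf]; have := ihe re; have := ihf rf; rewrite !evalE.
    have := ev_bitlen sM re; have := ev_bitlen sM rf.
    have := esize_gt0 e; have := esize_gt0 f; nia.
  - move=> e ihe f ihf [re rf]; have := ihe re; have := ihf rf; rewrite !evalE.
    have := ev_bitlen sM re; have := ev_bitlen sM rf.
    have := esize_gt0 e; have := esize_gt0 f; nia.
  - move=> e ihe f ihf [re rf]; have := ihe re; have := ihf rf; rewrite !evalE.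
    have := leq_mul (ev_bitlen sM re) (ev_bitlen sM rf).
    have := esize_gt0 e; have := esize_gt0 f; nia.
  - move=> e ihe f ihf [re rf]; have := ihe re; have := ihf rf; rewrite !evalE.
    have := leq_mul (ev_bitlen sM re) (ev_bitlen sM rf).
    have := esize_gt0 e; have := esize_gt0 f; nia.
case: e0 => //= [z|x|a e|e f|e f|e f|e f] H;
  [exact: (key (Const z))|exact: (key (Reg x))| |exact: (key (Add e f))|
   exact: (key (Defs.Sub e f))|exact: (key (Mul e f))|exact: (key (Div e f))].
by apply: (key (Arr 0 e)).
Qed.

Lemma small_bitlen v : small v -> (bitlen v <= y)%N.
Proof. by apply: bitlen_le; lia. Qed.

Lemma kap_ge : (100 * 100 * y ^ 2 <= kap)%N.
Proof. by rewrite /kap expnMn -[(100 ^ 2)%N]mulnn leq_pmulr //; lia. Qed.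

Lemma ecost_le20 M t e : safe M -> addressable M e -> (esize e <= 20)%N ->
  (ecost (st M t) e <= 1200 * y ^ 2)%N.
Proof.
move=> sM ae e20; apply: leq_trans (ecost_le t sM ae) _.
apply: (@leq_trans (3 * (20 * y) ^ 2)); last by rewrite expnMn; lia.
by rewrite leq_mul2l leq_exp2r // leq_mul2r e20 orbT.
Qed.

Lemma wp_weaken c k k' (Q Q' : memory -> Prop) M :
  wp c k Q M -> (k <= k')%N -> (forall M', Q M' -> Q' M') -> wp c k' Q' M.
Proof.
move=> h kk hQ sM t; have [M' [t' [h1 h2 h3 h4]]] := h sM t.
exists M', t'; split=> //; last exact: hQ.
by rewrite (leq_trans h2) // leq_add2l leq_mul2r kk orbT.
Qed.

Lemma wp_frame c k Q M :
  wp c k (fun M' => frame c M M' -> Q M') M -> wp c k Q M.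
Proof.
move=> h sM t; have [M' [t' [h1 h2 h3 h4]]] := h sM t.
exists M', t'; split=> //; apply: h4; exact: (exec_frame h1).
Qed.

Lemma wp_safe c k Q M : (safe M -> wp c k Q M) -> wp c k Q M.
Proof. by move=> h sM; exact: h. Qed.

Lemma wp_skip Q M : Q M -> wp Skip 0 Q M.
Proof. by move=> h sM t; exists M, t; split=> //; [exact: exec_skip|rewrite mul0n addn0]. Qed.

Lemma wp_seq c d k l Q M : wp c k (wp d l Q) M -> wp (Seq c d) (k + l) Q M.
Proof.
move=> h sM t; have [M' [t' [h1 h2 h3 h4]]] := h sM t.
have [M'' [t'' [h5 h6 h7 h8]]] := h4 h3 t'.
exists M'', t''; split=> //; first exact: exec_seq h1 h5.
by rewrite (leq_trans h6) // mulnDl addnA leq_add2r.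
Qed.

Lemma safe_setr M x v : safe M -> small v -> safe (setr M x v).
Proof. by move=> [h1 h2 h3] sv; split=> //= z; case: ifP. Qed.

Lemma safe_seta M a i v : safe M -> a = 4%N \/ small v -> safe (seta M a i v).
Proof.
move=> [h1 h2 h3] sv; split=> //= b k b4; case: eqP => [e|_]; last exact: h2.
subst b; case: sv => [e|sv] /=; first by rewrite e in b4.
by case: ifP => // _; exact: h2.
Qed.

Lemma wp_set_reg x e Q M :
  (esize e <= 20)%N -> readable M e -> small (ev M e) ->
  Q (setr M x (ev M e)) -> wp (Set_reg x e) 1 Q M.
Proof.
move=> e20 rM sv q sM t; exists (setr M x (ev M e)).
exists (t + (ecost (st M t) e + bitlen (ev M e)))%N; split=> //; last exact: safe_setr.
  have := exec_set_reg theta O (st M t) x e; by rewrite /= evalE.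
have ae : addressable M e by case: e rM {e20 sv q} => //= a e [].
rewrite leq_add2l mul1n; have := ecost_le20 t sM ae e20.
have := small_bitlen sv; have := kap_ge; nia.
Qed.

Lemma wp_set_arr a e f Q M :
  (esize e <= 20)%N -> (esize f <= 20)%N -> readable M e -> readable M f ->
  small (ev M f) ->
  Q (seta M a `|ev M e|%N (ev M f)) -> wp (Set_arr a e f) 1 Q M.
Proof.
move=> e20 f20 re rf sv q sM t; exists (seta M a `|ev M e|%N (ev M f)).
exists (t + (ecost (st M t) e + ecost (st M t) f + bitlen (ev M e) + bitlen (ev M f)))%N.
split=> //; last by apply: safe_seta => //; right.
  have := exec_set_arr theta O (st M t) a e f; by rewrite /= !evalE.
have ae : addressable M e by case: e re {e20 sv q} => //= b e [].
have af : addressable M f by case: f rf {f20 sv q} => //= b e' [].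
rewrite leq_add2l mul1n; have := ecost_le20 t sM ae e20; have := ecost_le20 t sM af f20.
have h : (esize e * y <= 20 * y)%N by rewrite leq_mul2r e20 orbT.
have := leq_trans (ev_bitlen sM re) h; have := small_bitlen sv; have := kap_ge; nia.
Qed.

Definition testable M e f : Prop :=
  [/\ addressable M e, addressable M f & readable M e \/ readable M f].

Lemma test_cost_le M t e f : (esize e <= 20)%N -> (esize f <= 20)%N -> safe M ->
  testable M e f -> (test_cost (st M t) e f <= kap)%N.
Proof.
move=> e20 f20 sM [ae af]; rewrite /test_cost !evalE.
have := ecost_le20 t sM ae e20; have := ecost_le20 t sM af f20; have := kap_ge.
have he : (esize e * y <= 20 * y)%N by rewrite leq_mul2r e20 orbT.
have hf : (esize f * y <= 20 * y)%N by rewrite leq_mul2r f20 orbT.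
move=> h1 h2 h3; case=> [/(ev_bitlen sM)|/(ev_bitlen sM)] h4.
  have := geq_minl (bitlen (ev M e)) (bitlen (ev M f)); nia.
have := geq_minr (bitlen (ev M e)) (bitlen (ev M f)); nia.
Qed.

Lemma wp_if e f c d k Q M :
  (esize e <= 20)%N -> (esize f <= 20)%N -> testable M e f ->
  (ev M e < ev M f -> wp c k Q M) -> (ev M f <= ev M e -> wp d k Q M) ->
  wp (If_lt e f c d) k.+1 Q M.
Proof.
move=> e20 f20 tM hc hd sM t.
have tc := test_cost_le t e20 f20 sM tM.
have [h|h] := ltP (ev M e) (ev M f).
  have [M' [t' [h1 h2 h3 h4]]] := hc h sM (t + test_cost (st M t) e f)%N.
  exists M', t'; split=> //; last by move: h2; rewrite mulSn; lia.
  by apply: exec_if; rewrite !evalE h.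
have [M' [t' [h1 h2 h3 h4]]] := hd h sM (t + test_cost (st M t) e f)%N.
exists M', t'; split=> //; last by move: h2; rewrite mulSn; lia.
by apply: exec_if; rewrite !evalE ltNge h.
Qed.

Lemma wp_while N K (Inv : nat -> memory -> Prop) e f c Q M :
  (esize e <= 20)%N -> (esize f <= 20)%N ->
  (forall M', readable M' e /\ readable M' f) ->
  Inv 0%N M ->
  (forall k M', frame c M M' -> Inv k M' -> ev M' e < ev M' f ->
     (k < N)%N /\ wp c K (Inv k.+1) M') ->
  (forall k M', frame c M M' -> Inv k M' -> ev M' f <= ev M' e -> Q M') ->
  wp (While_lt e f c) (N * K.+1 + 1) Q M.
Proof.
move=> e20 f20 rd I0 step stop sM t.
have tst M' : testable M' e f.
  have [re rf] := rd M'; split; last by left.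
    by case: e re {e20 rd step stop} => //= b e [].
  by case: f rf {f20 rd step stop} => //= b f [].
suff key n k M' t0 : (N = k + n)%N -> safe M' -> frame c M M' -> Inv k M' ->
    exists M'' t'', [/\ exec theta O (While_lt e f c) (st M' t0) (st M'' t''),
      (t'' <= t0 + (n * K.+1 + 1) * kap)%N, safe M'' & Q M''].
  by apply: (key N 0%N).
move: n k M' t0; have halt n k M' t0 : safe M' -> frame c M M' -> Inv k M' -> ev M' f <= ev M' e ->
    exists M'' t'', [/\ exec theta O (While_lt e f c) (st M' t0) (st M'' t''),
      (t'' <= t0 + (n * K.+1 + 1) * kap)%N, safe M'' & Q M''].
  move=> sM' fM Ik h; exists M', (t0 + test_cost (st M' t0) e f)%N.
  split=> //; last exact: (stop k).
    by apply: exec_while_stop; rewrite !evalE -leNgt.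
  by rewrite leq_add2l (leq_trans (test_cost_le t0 e20 f20 sM' (tst M'))) // leq_pmull // addn1.
elim=> [|n ih] k M' t0 Nk sM' fM Ik.
  have [h|h] := ltP (ev M' e) (ev M' f); last exact: (halt 0%N k).
  by have [] := step k M' fM Ik h; rewrite Nk addn0 ltnn.
have [h|h] := ltP (ev M' e) (ev M' f); last exact: (halt n.+1 k).
have tc := test_cost_le t0 e20 f20 sM' (tst M').
have [_ hw] := step k M' fM Ik h.
have [M1 [t1 [h1 h2 h3 h4]]] := hw sM' (t0 + test_cost (st M' t0) e f)%N.
have fM1 : frame c M M1.
  have [r1 a1] := exec_frame h1; have [r2 a2] := fM.
  by split=> [x hx|a ha]; [rewrite -r2 //; exact: r1|rewrite -a2 //; exact: a1].
have [M2 [t2 [h5 h6 h7 h8]]] := ih k.+1 M1 t1 ltac:(lia) h3 fM1 h4.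
exists M2, t2; split=> //.
  by apply: (@exec_while_loop _ theta O e f c (st M' t0) (st M1 t1)) => //; rewrite !evalE.
move: h2 h6 tc; move: (kap) => z; nia.
Qed.

Definition For i e c :=
  Seq (Set_reg i (Const 0)) (While_lt (Reg i) e (Seq c (Set_reg i (Add (Reg i) (Const 1))))).

Lemma wp_for (N : nat) K (Inv : nat -> memory -> Prop) i e c Q M :
  (esize e <= 20)%N -> (N < 2 ^ y)%N -> i \notin mod_regs c ->
  (forall M', readable M' e) ->
  (forall M', frame (For i e c) M M' -> ev M' e = N%:Z) ->
  (forall k M' v, Inv k M' -> Inv k (setr M' i v)) ->
  Inv 0%N M ->
  (forall k M', frame (For i e c) M M' -> (k < N)%N -> mr M' i = k%:Z -> Inv k M' ->
     wp c K (Inv k.+1) M') ->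
  (forall M', frame (For i e c) M M' -> Inv N M' -> Q M') ->
  wp (For i e c) (N * K.+2 + 2) Q M.
Proof.
move=> e20 Ny ic rd eN Istab I0 step fin.
have -> : (N * K.+2 + 2 = 1 + (N * (K + 1).+1 + 1))%N by rewrite addn1; lia.
apply: wp_seq; apply: wp_set_reg => //=; first by rewrite /small expn_gt0.
set M0 := setr M i 0.
have fr0 M' : frame (Seq c (Set_reg i (Add (Reg i) (Const 1)))) M0 M' -> frame (For i e c) M M'.
  move=> [h1 h2]; split=> [x /=|a] /=; last by move=> ha; apply: h2.
  rewrite in_cons negb_or => /andP[xi xc].
  by rewrite h1 //=; rewrite (negPf xi).
apply: (@wp_while N (K + 1) (fun k M' => [/\ (k <= N)%N, mr M' i = k%:Z & Inv k M'])) => //.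
- by split=> //=; [rewrite eqxx|exact: Istab].
- move=> k M' /fr0 fM [kN ik Ik] /=; rewrite ik eN // ltz_nat => lt; split=> //.
  apply: wp_seq; apply: wp_frame; apply: wp_weaken (step k M' fM lt ik Ik) _ _ => // M1 I1 [fr1 _].
  have i1 : mr M1 i = k%:Z by rewrite fr1.
  apply: wp_set_reg => //=; rewrite i1 -PoszD addn1.
    by rewrite /small absz_nat (leq_ltn_trans lt).
  by split=> //=; [rewrite eqxx|exact: Istab].
- move=> k M' /fr0 fM [kN ik Ik] /=; rewrite ik eN // lez_nat => Nk.
  by apply: fin => //; have -> : N = k by lia.
Qed.

Lemma wp_param x i e Q M (k := `|ev M e|%N) (v := Num.floor (2 ^+ k * theta i)) :
  (esize e <= 20)%N -> readable M e -> (k <= y)%N -> small v ->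
  Q (setr M x v) -> wp (Param x i e) 1 Q M.
Proof.
move=> e20 rM ky sv q sM t; exists (setr M x v).
exists (t + (ecost (st M t) e + k + bitlen v))%N; split=> //; last exact: safe_setr.
  have := exec_param theta O x i e (st M t); by rewrite /= evalE.
have ae : addressable M e by move: rM; clear; case: e => //= a e [].
rewrite leq_add2l mul1n; have := ecost_le20 t sM ae e20.
have := small_bitlen sv; have := kap_ge; nia.
Qed.

Lemma wp_query Q M (J := mem_instance (st M 0)) :
  (rk J <= y)%N -> (dm J <= y)%N -> good_query J ->
  (forall k, (k < dm J)%N -> small (denq (entry (O J) 0 k))) ->
  (forall M', mr M' = mr M -> (forall a, a \notin [:: 4; 5]%N -> ma M' a = ma M a) ->
     (forall k, (k < dm J)%N -> ma M' 4 k = numq (entry (O J) 0 k) /\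
        ma M' 5 k = denq (entry (O J) 0 k)) -> Q M') ->
  wp Query 1 Q M.
Proof.
move=> ny my gJ sden q sM t.
pose put (g : rat -> int) (f : nat -> int) k :=
  if (k < dm J)%N then g (entry (O J) 0 k) else f k.
pose A4 : nat -> nat -> int := [eta ma M with 4%N |-> put numq (ma M 4)].
pose M' := Memory (mr M) [eta A4 with 5%N |-> put denq (ma M 5)] (rcons (mq M) J).
exists M', (t + (mem_size (st M t) + 1))%N; split.
- exact: (exec_query theta O (st M t)).
- have [sr sa _] := sM.
  have b a k : a != 4%N -> (bitlen (arrs (st M t) a k) <= y)%N.
    by move=> a4; apply: small_bitlen; exact: sa.
  have : (mem_size (st M t) <= rk J * dm J * (2 * y) + dm J * (2 * y))%N.
    rewrite /mem_size; apply: leq_add.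
      rewrite -[X in (_ <= X * _)%N]card_ord -sum_nat_const; apply: leq_sum => k _.
      by have := b 0%N k isT; have := b 1%N k isT; lia.
    rewrite -[X in (_ <= X * _)%N]card_ord -sum_nat_const; apply: leq_sum => k _.
    by have := b 2%N k isT; have := b 3%N k isT; lia.
  rewrite leq_add2l mul1n /kap => h.
  have h1 : (rk J * dm J <= y * y)%N by exact: leq_mul.
  have : (rk J * dm J * (2 * y) + dm J * (2 * y) <= 4 * y ^ 3)%N by nia.
  move: (mem_size _) h => z; nia.
- have [sr sa sq] := sM; split=> //=.
    move=> a k a4; case: eqP => _; last by rewrite /A4 /= (negPf a4); exact: sa.
    by rewrite /put; case: ifP => [/sden //|_]; exact: sa.
  move=> J'; rewrite -cats1 => h; case: (List.in_app_or _ _ _ h) => [/sq //|].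
  by case=> // <-.
- apply: q => //=.
    by move=> a; rewrite !inE negb_or /A4 /= => /andP[/negPf -> /negPf ->].
  by move=> k kJ; rewrite /A4 /= /put kJ.
Qed.

End Machine.

(** * Codes of sparse integer vectors *)

(* Little-endian code of an integer vector: an even number moves on by a block
   of [b] positions, an odd one adds -1 or 1 at a position of the current
   block. *)
Fixpoint zdecode_fuel (b fuel c pos j : nat) : int :=
  if fuel is f.+1 then
    if c == 0%N then 0
    else if odd c then
      (if (pos + c./2 %% b)%N == j then (-1) ^+ odd (c./2 %/ b) else 0)
        + zdecode_fuel b f (c./2 %/ b)./2 pos j
    else zdecode_fuel b f c./2 (pos + b) j
  else 0.

Definition zdecode b c pos j := zdecode_fuel b c c pos j.

Lemma zdecode_fuelE b f c pos j : (c <= f)%N -> zdecode_fuel b f c pos j = zdecode b c pos j.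
Proof.
suff key : forall f g c pos, (c <= f)%N -> (c <= g)%N ->
    zdecode_fuel b f c pos j = zdecode_fuel b g c pos j by move=> cf; exact: key.
move=> {}f; elim: f => [|f ih] [|g] {}c {}pos cf cg //=.
- by have -> : c = 0%N by lia.
- by have -> : c = 0%N by lia.
have [//|c0] := eqVneq c 0%N.
have h k : (c <= k.+1)%N -> (c./2 <= k)%N /\ ((c./2 %/ b)./2 <= k)%N.
  by have := leq_div c./2 b; lia.
have [? ?] := h _ cf; have [? ?] := h _ cg.
by case: ifP => _; rewrite (ih g).
Qed.

Lemma zdecode0 b pos j : zdecode b 0 pos j = 0.
Proof. by []. Qed.

Lemma zdecode_odd b c pos j : odd c ->
  zdecode b c pos j = (if (pos + c./2 %% b)%N == j then (-1) ^+ odd (c./2 %/ b) else 0)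
        + zdecode b (c./2 %/ b)./2 pos j.
Proof.
case: c => // c oc; rewrite {1}/zdecode; cbn -[half odd divn modn].
rewrite oc zdecode_fuelE //; have := leq_div c.+1./2 b; lia.
Qed.

Lemma zdecode_even b c pos j : ~~ odd c -> zdecode b c pos j = zdecode b c./2 (pos + b) j.
Proof.
case: c => // c oc; rewrite {1}/zdecode; cbn -[half odd divn modn].
rewrite (negPf oc) zdecode_fuelE //; lia.
Qed.

Lemma zdecode_put b c pos j0 (s : bool) : (pos <= j0 < pos + b)%N ->
  let h := ((s + c.*2) * b + (j0 - pos))%N in
  forall j, zdecode b h.*2.+1 pos j = (if j0 == j then (-1) ^+ s else 0) + zdecode b c pos j.
Proof.
move=> hj h j; pose q := (s + c.*2)%N.
have hm : (h %% b = j0 - pos)%N by rewrite modnMDl modn_small //; lia.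
have hd : (h %/ b = q)%N by rewrite divnMDl ?divn_small ?addn0 //; lia.
rewrite zdecode_odd /= ?odd_double // uphalf_double hm hd /q half_bit_double.
by rewrite oddD odd_double addbF oddb subnKC //; lia.
Qed.

Lemma zdecode_surj b M U (z : nat -> int) pos : (0 < b)%N -> (pos + M.+1 * b <= U)%N ->
  (forall j, z j != 0 -> (pos <= j < pos + M.+1 * b)%N) ->
  exists c, (c < 2 ^ M * (4 * b) ^ (\sum_(j < U) `|z j|))%N /\
    forall j, zdecode b c pos j = z j.
Proof.
move=> b0; move: z pos.
have step (z : nat -> int) pos N m0 : (pos + m0.+1 * b <= U)%N ->
    (forall j, z j != 0 -> (pos <= j < pos + m0.+1 * b)%N) ->
    (\sum_(j < U) `|z j|)%N = N ->
    (forall z' : nat -> int, (\sum_(j < U) `|z' j|)%N.+1 = N ->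
       (forall j, z' j != 0 -> (pos <= j < pos + m0.+1 * b)%N) ->
       exists c, (c < 2 ^ m0 * (4 * b) ^ (\sum_(j < U) `|z' j|))%N /\
         forall j, zdecode b c pos j = z' j) ->
    forall j0, (pos <= j0 < pos + b)%N -> z j0 != 0 ->
    exists c, (c < 2 ^ m0 * (4 * b) ^ (\sum_(j < U) `|z j|))%N /\
      forall j, zdecode b c pos j = z j.
  move=> hU supp sN ih j0 hj0 zj0.
  have j0U : (j0 < U)%N by move: hU; rewrite mulSn; lia.
  pose s := z j0 < 0; pose z' j : int := if j == j0 then z j0 - (-1) ^+ s else z j.
  have zz : (`|z j0| = (`|z' j0|).+1)%N.
    by rewrite /z' eqxx /s; move: zj0; case: (ltP (z j0) 0); rewrite ?expr0 ?expr1; lia.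
  have sN' : ((\sum_(j < U) `|z' j|).+1 = N)%N.
    rewrite -sN (bigD1 (Ordinal j0U)) //= [RHS](bigD1 (Ordinal j0U)) //= zz addSn.
    congr (_ + _).+1; apply: eq_bigr => i ne; rewrite /z'.
    by have /negPf -> : val i != j0 by apply: contraNneq ne => e; apply/eqP/val_inj.
  have supp' j : z' j != 0 -> (pos <= j < pos + m0.+1 * b)%N.
    by rewrite /z'; case: (eqVneq j j0) => [-> _|_]; exact: supp.
  have [c [cb cd]] := ih z' sN' supp'.
  exists (((s + c.*2) * b + (j0 - pos)).*2.+1)%N; split.
    have sb : (s <= 1)%N by exact: leq_b1.
    rewrite sN -sN' expnS; move: cb; rewrite mulnCA; move: (2 ^ m0 * _)%N => X.
    move: hj0; nia.
  move=> j; rewrite zdecode_put // cd /z' eq_sym; case: eqP => [->|_]; rewrite ?add0r //; ring.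
elim: M => [|M ihM] z pos; move sN: (\sum_(j < U) `|z j|)%N => N; rewrite -sN.
  elim: N z sN => [|N ihN] z sN hU supp;
    (have [/hasP[j0]|/hasPn none] := boolP (has (fun j => z j != 0) (iota pos b));
     [rewrite mem_iota => hj zj; apply: (step z pos _ 0%N hU supp sN _ j0 hj zj) => z'|]).
  - by [].
  - exists 0%N; split=> [|j]; rewrite ?muln_gt0 ?expn_gt0 ?muln_gt0 ?b0 // zdecode0.
    case: (eqVneq (z j) 0) => // zj; have := none j; rewrite mem_iota zj.
    by have := supp j zj; rewrite mul1n => h /(_ h).
  - by case=> e h; exact: ihN.
  - exists 0%N; split=> [|j]; rewrite ?muln_gt0 ?expn_gt0 ?muln_gt0 ?b0 // zdecode0.
    case: (eqVneq (z j) 0) => // zj; have := none j; rewrite mem_iota zj.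
    by have := supp j zj; rewrite mul1n => h /(_ h).
have move_on (zz : nat -> int) : (pos + M.+2 * b <= U)%N ->
    (forall j, zz j != 0 -> (pos <= j < pos + M.+2 * b)%N) ->
    {in iota pos b, forall j, ~~ (zz j != 0)} ->
    exists c, (c < 2 ^ M.+1 * (4 * b) ^ (\sum_(j < U) `|zz j|))%N /\
    forall j, zdecode b c pos j = zz j.
  move=> hU supp none.
  have [||c [cb cd]] := ihM zz (pos + b)%N; first by move: hU; rewrite !mulSn; lia.
    move=> j zj; have := supp j zj; have := none j; rewrite mem_iota zj !mulSn => h1 h2.
    case: (ltnP j (pos + b)) => h3; last by lia.
    by have := h1 ltac:(lia).
  exists c.*2; split=> [|j]; first by rewrite expnS; lia.
  by rewrite zdecode_even ?odd_double // doubleK.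
elim: N z sN => [|N ihN] z sN hU supp;
  (have [/hasP[j0]|/hasPn none] := boolP (has (fun j => z j != 0) (iota pos b));
   [rewrite mem_iota => hj zj; apply: (step z pos _ M.+1 hU supp sN _ j0 hj zj) => z'
   |exact: move_on]).
- by [].
- by case=> e h; exact: ihN.
Qed.

(** * Norms and scores *)

Section Norms.
Variable R : realType.
Implicit Types (p q : R) (m : nat).

Lemma ler_powRl p (a b : R) : 0 <= p -> 0 <= a -> a <= b -> a `^ p <= b `^ p.
Proof.
move=> p0 a0 ab; apply: ge0_ler_powR => //; rewrite ?nnegrE //.
exact: le_trans ab.
Qed.

Lemma ltr_powRl p (a b : R) : 0 < p -> 0 <= a -> a < b -> a `^ p < b `^ p.
Proof.
move=> p0 a0 ab; apply: gt0_ltr_powR => //; rewrite ?nnegrE //.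
exact: ltW (le_lt_trans a0 ab).
Qed.

Lemma lpnorm_ge0 (q : \bar R) m (x : 'rV[R]_m) : 0 <= lpnorm q x.
Proof.
case: q => [r| |] //=; first exact: powR_ge0.
exact: bigmax_ge_id.
Qed.

Lemma lpnorm_powR p m (x : 'rV[R]_m) : 1 <= p ->
  lpnorm p%:E x `^ p = \sum_j `|x ord0 j| `^ p.
Proof.
move=> p1; rewrite /= -powRrM mulVf ?powRr1 //; last by apply/eqP; lra.
by apply: sumr_ge0 => j _; exact: powR_ge0.
Qed.

(* The l_q norm of the all-ones vector. *)
Definition unit_lpnorm (q : \bar R) m : R :=
  if q is r%:E then m%:R `^ r^-1 else 1.

Lemma lpnorm_le (q : \bar R) m (x : 'rV[R]_m) (a : R) : (1%:E <= q)%E -> 0 <= a ->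
  (forall j, `|x ord0 j| <= a) -> lpnorm q x <= unit_lpnorm q m * a.
Proof.
case: q => [r| |] //= q1 a0 h; last by rewrite mul1r; apply: bigmax_le.
move: q1; rewrite lee_fin => r1.
have r0 : 0 < r by lra.
have -> : m%:R `^ r^-1 * a = (\sum_(j < m) a `^ r) `^ r^-1.
  rewrite sumr_const card_ord -[(_ `^ _) *+ m]mulr_natl [in RHS]powRM ?powR_ge0 //.
  by rewrite -[in RHS]powRrM divff ?powRr1 // gt_eqF.
apply: ler_powRl; first by rewrite invr_ge0 ltW.
  by apply: sumr_ge0 => j _; exact: powR_ge0.
by apply: ler_sum => j _; apply: ler_powRl => //; exact: ltW.
Qed.

(* Young's inequality u^p <= (p/q) u^q + (1 - p/q) replaces Hoelder. *)
Lemma sum_powR_le p (q : \bar R) m (x : 'rV[R]_m) (a : R) :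
  1 <= p -> (p%:E < q)%E -> 0 <= a -> lpnorm q x <= unit_lpnorm q m * a ->
  \sum_j `|x ord0 j| `^ p <= m%:R * a `^ p.
Proof.
move=> p1; have p0 : 0 < p by lra.
have sumc (c : R) : \sum_(j < m) c = m%:R * c.
  by rewrite sumr_const card_ord mulr_natl.
case: q => [r| |] //= pq a0 h; last first.
  rewrite -sumc; apply: ler_sum => j _; apply: ler_powRl => //; first exact: ltW.
  rewrite mul1r in h; apply: le_trans h.
  exact: (le_bigmax _ (fun j => `|x ord0 j|)).
move: pq; rewrite lte_fin => pr; have r0 : 0 < r by lra.
have hr : \sum_j `|x ord0 j| `^ r <= m%:R * a `^ r.
  have s0 : 0 <= \sum_j `|x ord0 j| `^ r by apply: sumr_ge0 => j _; exact: powR_ge0.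
  have := ler_powRl (ltW r0) (powR_ge0 _ _) h.
  by rewrite powRM ?powR_ge0 // -!powRrM mulVf ?gt_eqF // !powRr1.
move: a0; rewrite le_eqVlt => /predU1P[a0|a0].
  rewrite -a0 powR0 ?gt_eqF // mulr0 in hr.
  have /psumr_eq0P hz : \sum_j `|x ord0 j| `^ r = 0.
    by apply/eqP; rewrite eq_le hr sumr_ge0 // => j _; exact: powR_ge0.
  rewrite big1 ?mulr_ge0 ?powR_ge0 // => j _.
  have := hz (fun i _ => powR_ge0 _ _) j isT => /powR_eq0_eq0 ->.
  by rewrite powR0 // gt_eqF.
have ap0 : 0 < a `^ p by exact: powR_gt0.
have ar0 : 0 < a `^ r by exact: powR_gt0.
pose t := p / r.
have t01 : 0 < t < 1 by rewrite divr_gt0 //= ltr_pdivrMr // mul1r.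
have /andP[t0 t1] := t01.
have young j : `|x ord0 j| `^ p <= a `^ p * (t * (`|x ord0 j| `^ r / a `^ r) + (1 - t)).
  set u := `|x ord0 j| / a.
  have u0 : 0 <= u by rewrite divr_ge0 // ltW.
  have -> : `|x ord0 j| = a * u by rewrite /u mulrCA divff ?mulr1 // gt_eqF.
  rewrite ![(a * u) `^ _]powRM ?(ltW a0) // [a `^ r * _]mulrC mulfK ?gt_eqF // ler_pM2l //.
  have := @conjugate_powR R (u `^ p) 1 t^-1 (1 - t)^-1 (powR_ge0 _ _) ler01.
  rewrite !invr_gt0 subr_gt0 t0 t1 => /(_ isT isT).
  rewrite !invrK powR1 mulr1 mul1r -powRrM => /(_ _).
  have -> : p * t^-1 = r by rewrite /t invf_div mulrCA divff ?mulr1 // gt_eqF.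
  rewrite [_ * t]mulrC; apply; lra.
apply: le_trans (ler_sum _ (fun j _ => young j)) _.
rewrite -mulr_sumr big_split /= sumc -mulr_sumr -mulr_suml.
rewrite [X in _ <= X]mulrC ler_pM2l //.
have : (\sum_j `|x ord0 j| `^ r) / a `^ r <= m%:R by rewrite ler_pdivrMr.
move: (_ / _) => S hS; have : t * S <= t * m%:R by rewrite ler_pM2l.
lra.
Qed.

Lemma powRD_le p (a b : R) : 1 <= p -> 0 <= a -> 0 <= b ->
  (a + b) `^ p <= 2 `^ p * (a `^ p + b `^ p).
Proof.
move=> p1 a0 b0; have p0 : 0 <= p by lra.
wlog ab : a b a0 b0 / a <= b.
  move=> h; case: (leP a b) => [|/ltW] ba; first exact: h.
  by rewrite addrC [X in _ * X]addrC; exact: h.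
rewrite mulrDr -[in X in _ <= _ + X]powRM //.
apply: le_trans (_ : (2 * b) `^ p <= _); first by apply: ler_powRl; lra.
by rewrite lerDr mulr_ge0 ?powR_ge0.
Qed.

(* p times log2 of |x|, rounded to an integer; [l] is the integer part of
   log2 (x^2). *)
Definition score_exp p (l : nat) : nat :=
  `|(Num.floor (2 ^+ l * p) * l%:Z %/ (2 * 2 ^+ l))%Z|%N.

(* The quotient is 1 for x <> 0, and 0 for x = 0 since 0 %/ 0 = 0. *)
Definition score1 p (x : int) : int :=
  ((x * x) %/ (x * x))%Z * 2 ^+ score_exp p (trunc_log 2 `|(x * x)%R|%N).

Definition score p m (x : nat -> int) : int := \sum_(j < m) score1 p (x j).

Lemma score_exp_ge0 p l : 0 <= p ->
  (Num.floor (2 ^+ l * p) * l%:Z %/ (2 * 2 ^+ l))%Z = (score_exp p l)%:Z.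
Proof.
move=> p0; rewrite /score_exp gez0_abs // divz_ge0 ?mulr_gt0 ?exprn_gt0 //.
by rewrite mulr_ge0 // floor_ge0 mulr_ge0 // exprn_ge0.
Qed.

Lemma floor_div_bounds (a : int) (b : int) : 0 < b ->
  ((a %/ b)%Z%:~R <= a%:~R / b%:~R :> R) /\ (a%:~R / b%:~R < (a %/ b)%Z%:~R + 1 :> R).
Proof.
move=> b0; have br : 0 < b%:~R :> R by rewrite ltr0z.
rewrite ler_pdivlMr // ltr_pdivrMr // -[1]/(1%:~R) -intrD -!intrM ler_int ltr_int.
have := divz_eq a b; have := modz_ge0 a (lt0r_neq0 b0); have := ltz_pmod a b0.
move: (a %/ b)%Z (a %% b)%Z => d r; nia.
Qed.

Lemma natr_lt_exp2 l : l%:R < 2 ^+ l :> R.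
Proof. by rewrite -natrX ltr_nat ltn_expl. Qed.

Lemma score_exp_bounds p l : 0 <= p ->
  p * l%:R / 2 - 2 < (score_exp p l)%:R <= p * l%:R / 2.
Proof.
move=> p0.
set P : R := 2 ^+ l; have P0 : 0 < P by rewrite exprn_gt0.
have lP : l%:R < P by exact: natr_lt_exp2.
have /andP[F1 F2] := floor_itv (2 ^+ l * p).
have := @floor_div_bounds (Num.floor (2 ^+ l * p) * l%:Z) (2 * 2 ^+ l)
          ltac:(by rewrite mulr_gt0 // exprn_gt0).
rewrite score_exp_ge0 //; move: F1 F2; rewrite -/P; move: (Num.floor _) => F F1 F2.
have -> : (2 * 2 ^+ l : int)%:~R = 2 * P by rewrite intrM rmorphXn.
rewrite intrM -[(Posz l)%:~R]/(l%:R) -[(Posz (score_exp p l))%:~R]/((score_exp p l)%:R) => -[h1 h2].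
rewrite intrD in F2.
have l0 : 0 <= l%:R :> R by [].
have P2 : 0 < 2 * P by lra.
apply/andP; split.
  suff : p * l%:R / 2 - 1 <= F%:~R * l%:R / (2 * P) by lra.
  rewrite ler_pdivlMr //.
  have : (P * p - 1) * l%:R <= F%:~R * l%:R by rewrite ler_wpM2r //; lra.
  nra.
apply: le_trans h1 _; rewrite ler_pdivrMr //.
have : F%:~R * l%:R <= P * p * l%:R by rewrite ler_wpM2r.
nra.
Qed.

Lemma score1_bounds p (x : int) : 1 <= p ->
  (score1 p x)%:~R <= `|x%:~R| `^ p :> R /\
  `|x%:~R| `^ p <= 4 * 2 `^ (p / 2) * (score1 p x)%:~R :> R.
Proof.
move=> p1; have p0 : 0 <= p by lra.
rewrite /score1; have [->|x0] := eqVneq x 0.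
  by rewrite mulr0 div0z mul0r mulr0 normr0 powR0 //; apply/eqP; lra.
have xx0 : x * x != 0 by rewrite mulf_neq0.
rewrite divzz xx0 mul1r rmorphXn /= -powR_mulrn //.
set N := `|(x * x)%R|%N; set l := trunc_log 2 N.
have N0 : (0 < N)%N by rewrite absz_gt0.
have /andP[l1 l2] := trunc_log_bounds (isT : (1 < 2)%N) N0.
have NE : N%:R = `|x%:~R| ^+ 2 :> R.
  by rewrite /N natr_absz intr_norm intrM normrM expr2.
have xp : `|x%:~R| `^ p = N%:R `^ (p / 2).
  by rewrite NE -powR_mulrn // -powRrM mulrCA divff ?mulr1.
have e2 k r : (2 ^ k)%:R `^ r = 2 `^ (k%:R * r) :> R.
  by rewrite natrX -powR_mulrn // powRrM.
have p20 : 0 <= p / 2 by lra.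
have /andP[u1 u2] := score_exp_bounds l p0.
rewrite xp; split.
  apply: (@le_trans _ _ ((2 ^ l)%:R `^ (p / 2))); last by apply: ler_powRl => //; rewrite ler_nat.
  by rewrite e2; apply: ler_powR; lra.
apply: (@le_trans _ _ ((2 ^ l.+1)%:R `^ (p / 2))).
  by apply: ler_powRl => //; rewrite ler_nat ltnW.
have -> : 4 = 2 `^ 2 :> R by rewrite (powR_mulrn 2) //; lra.
rewrite e2 -!powRD ?pnatr_eq0 ?implybT //; apply: ler_powR; first lra.
rewrite -natr1; lra.
Qed.

Lemma score1_ge0 p x : 0 <= score1 p x.
Proof. by rewrite /score1 divzz mulr_ge0 ?exprn_ge0. Qed.

End Norms.

Lemma truncate_bounds (x : int) (g : nat) : (0 < g)%N ->
  let z := sgz x * (`|x| %/ g)%N in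
  `|x - g%:Z * z| <= g%:Z - 1 /\ `|g%:Z * z| <= `|x|.
Proof.
move=> g0 z; have h1 := divn_eq `|x| g; have h2 := ltn_pmod `|x| g0.
have key (v : int) : 0 <= v -> v = (`|x| %/ g * g + `|x| %% g)%N%:Z ->
    `|v - g%:Z * (`|x| %/ g)%N| <= g%:Z - 1 /\ `|g%:Z * (`|x| %/ g)%N| <= v.
  move=> v0 ->; rewrite PoszD PoszM mulrC addrAC subrr add0r.
  by move: (_ %/ g)%N (_ %% g)%N h2; clear => d r h2; rewrite -PoszM; lia.
rewrite {}/z; case: sgzP => [x0|x0|x0].
- by rewrite x0 !mul0r mulr0 subrr normr0; split=> //; move: g0; clear; lia.
- rewrite mul1r; apply: key; first exact: ltW.
  by rewrite -h1; move: x0; clear; lia.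
- rewrite mulN1r mulrN opprK normrN -[`|x + _|]normrN opprD.
  by apply: key; rewrite ?oppr_ge0 ?ltW // -h1; move: x0; clear; lia.
Qed.

Section Code.
Variable R : realType.
Implicit Types (p e : R) (m : nat).

Definition psum p m (x : nat -> int) : R := \sum_(j < m) `|(x j)%:~R| `^ p.

Lemma psum_ge0 p m x : 0 <= psum p m x.
Proof. by apply: sumr_ge0 => j _; exact: powR_ge0. Qed.

Lemma log2_inv_ge1 e : 0 < e < 1 / 100 -> 1 <= log2 (1 / e).
Proof.
move=> /andP[e0 e1]; rewrite /log2 div1r ler_pdivlMr ?ln_gt0 ?ltr1n // mul1r.
rewrite ler_ln ?posrE ?invr_gt0 // -div1r ler_pdivlMr //; lra.
Qed.

Lemma powR_log2 (a : R) : 0 < a -> 2 `^ (log2 a) = a.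
Proof.
move=> a0; rewrite /powR pnatr_eq0 /= /log2 divfK ?lnK ?posrE //.
by rewrite gt_eqF // ln_gt0 // ltr1n.
Qed.

(* A position is moved by blocks at most m/b <= E/2 times, and each of the N
   unit entries costs log2(4b) <= (3/2) log2(1/e) bits, E/2 bits in total. *)
Lemma code_bound e m E N (b := (2 * m %/ E).+1) : 0 < e < 1 / 100 ->
  e * m%:R <= E%:R -> (0 < E)%N -> N%:R * (3 * log2 (1 / e)) <= E%:R ->
  (2 ^ (m %/ b) * (4 * b) ^ N <= 2 ^ E)%N.
Proof.
move=> he; have /andP[e0 e1] := he; move=> emE E0 hN.
have L1 := log2_inv_ge1 he; set L := log2 (1 / e) in hN L1.
have E0r : 0 < E%:R :> R by rewrite ltr0n.
have hM : (m %/ b * 2 <= E)%N.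
  have h1 := leq_trunc_div m b.
  have h2 : (2 * m < b * E)%N by exact: ltn_ceil.
  move: (m %/ b)%N h1 => M; move: h2; nia.
have hb : (4 * b)%:R <= (1 / e) `^ (3 / 2).
  have b1 : b%:R <= 2 / e + 1 :> R.
    rewrite /b -natr1 lerD2r ler_pdivlMr //.
    have h1 : (2 * m %/ E)%:R * E%:R <= 2 * m%:R :> R.
      by rewrite -!natrM ler_nat leq_trunc_div.
    have : (2 * m %/ E)%:R * (e * m%:R) <= (2 * m %/ E)%:R * E%:R :> R by rewrite ler_wpM2l.
    have : 0 <= (2 * m %/ E)%:R :> R by [].
    have [->|m0] := posnP m; first by move=> *; rewrite muln0 div0n mul0r.
    have m0r : 0 < m%:R :> R by rewrite ltr0n.
    move: (_ %/ _)%:R h1 => k h1 k0 h2.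
    have : k * e * m%:R <= 2 * m%:R by lra.
    by rewrite ler_pM2r //; lra.
  have ie : 100 <= 1 / e by rewrite ler_pdivlMr //; lra.
  have i0 : 0 < 1 / e by lra.
  have -> : (3 / 2 : R) = 1 + 2^-1 by lra.
  rewrite powRD ?(gt_eqF i0) ?implybT // powRr1 ?ltW //.
  have : 10 <= (1 / e) `^ 2^-1.
    apply: le_trans (_ : 100 `^ 2^-1 <= _); last by apply: ler_powRl; rewrite // invr_ge0.
    have -> : 100 = 10 `^ 2 :> R by rewrite (powR_mulrn 2) //; lra.
    by rewrite -powRrM divff ?powRr1.
  have e2 : 2 / e = 2 * (1 / e) by lra.
  rewrite e2 {e2} in b1.
  move: (1 / e) ie i0 b1 => i ie i0 b1 h.
  rewrite natrM; have : i * 10 <= i * (i `^ 2^-1) by rewrite ler_pM2l.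
  lra.
rewrite -(@ler_nat R) natrM !natrX -!powR_mulrn //.
have i0 : 0 < 1 / e by rewrite divr_gt0.
have : (4 * b)%:R `^ N%:R <= 2 `^ (E%:R / 2) :> R.
  apply: le_trans (_ : ((1 / e) `^ (3 / 2)) `^ N%:R <= _); first exact: ler_powRl.
  rewrite -(powR_log2 i0) -/L -!powRrM; apply: ler_powR; lra.
have : 2 `^ (m %/ b)%:R <= 2 `^ (E%:R / 2) :> R.
  apply: ler_powR; first lra.
  by rewrite ler_pdivlMr // -natrM ler_nat.
move=> h1 h2; apply: le_trans (ler_pM (powR_ge0 _ _) (powR_ge0 _ _) h1 h2) _.
by rewrite -powRD ?pnatr_eq0 ?implybT // -splitr.
Qed.

Lemma exists_code p e m E (X : nat -> int) (b := (2 * m %/ E).+1) :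
  1 <= p -> 0 < e < 1 / 100 -> e * m%:R <= E%:R -> (0 < E)%N ->
  exists k c : nat, let g := 2 ^+ k : int in
    [/\ (c < 2 ^ E)%N,
        forall j, (j < m)%N -> `|X j - g * zdecode b c 0 j| <= g - 1 /\
                               `|g * zdecode b c 0 j| <= `|X j|,
        m%:R * (g%:~R - 1) `^ p <= 2 `^ p * (3 * log2 (1 / e) / e) * psum p m X
      & k = 0%N \/ (2 ^+ k.-1) `^ p <= psum p m X].
Proof.
move=> p1 he emE E0; have /andP[e0 e1] := he.
have L1 := log2_inv_ge1 he; set L := log2 (1 / e) in L1 *.
have p0 : 0 < p by lra.
pose N := Num.truncn (E%:R / (3 * L)).
have L3 : 0 < 3 * L by lra.
have /andP[N1 N2] : N%:R <= E%:R / (3 * L) < N.+1%:R.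
  by apply: truncn_itv; rewrite divr_ge0 // ltW.
rewrite ler_pdivlMr // in N1; rewrite ltr_pdivrMr // in N2.
have ex : exists k, psum p m X < (2 ^+ k) `^ p * N.+1%:R.
  have [k hk] : exists k : nat, psum p m X < k%:R.
    by exists (Num.truncn (psum p m X)).+1; exact: truncnS_gt.
  exists k; apply: lt_le_trans hk _.
  have h1 : k%:R <= 2 ^+ k :> R by apply: ltW; exact: natr_lt_exp2.
  have h2 : 1 <= 2 ^+ k :> R by apply: exprn_ege1; lra.
  have h3 : 2 ^+ k <= (2 ^+ k) `^ p :> R by apply: le1r_powR.
  apply: le_trans (_ : (2 ^+ k) `^ p <= _); first by lra.
  by rewrite ler_peMr ?powR_ge0 // ler1n.
case: (ex_minnP ex) => k hk kmin.
pose g : nat := (2 ^ k)%N; have g0 : (0 < g)%N by rewrite expn_gt0.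
have gE : 2 ^+ k = g%:Z by rewrite /g -natz natrX.
pose z j : int := if (j < m)%N then sgz (X j) * (`|X j| %/ g)%N else 0.
have zabs j : (`|z j|%N = if (j < m)%N then `|X j| %/ g else 0)%N.
  rewrite /z; case: ifP => // _; rewrite abszM absz_nat.
  by case: sgzP => [->|_|_]; rewrite ?div0n ?muln0 ?mul1n.
set M := (m %/ b)%N.
have mU : (m <= 0 + M.+1 * b)%N by rewrite add0n ltnW // ltn_ceil.
have zS : (\sum_(j < (0 + M.+1 * b)%N) `|z j| <= N)%N.
  have -> : (\sum_(j < (0 + M.+1 * b)%N) `|z j| = \sum_(j < m) `|X j| %/ g)%N.
    rewrite (big_ord_widen _ (fun j => `|X j| %/ g)%N mU) [RHS]big_mkcond /=.
    by apply: eq_bigr => j _; rewrite zabs.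
  rewrite -ltnS -(@ltr_nat R) natr_sum.
  have gp0 : 0 < g%:R `^ p :> R by rewrite powR_gt0 // ltr0n.
  rewrite -(ltr_pM2l gp0); apply: le_lt_trans (_ : psum p m X < _); last first.
    by move: hk; rewrite /g natrX.
  rewrite mulr_sumr; apply: ler_sum => j _.
  set d := (_ %/ g)%N.
  have h : d%:R <= d%:R `^ p :> R.
    case: d => [|d]; first by rewrite powR_ge0.
    by apply: le1r_powR; rewrite ?ler1n.
  apply: le_trans (_ : g%:R `^ p * d%:R `^ p <= _); first by rewrite ler_pM2l.
  rewrite -powRM //; apply: ler_powRl; [exact: ltW|by rewrite mulr_ge0|].
  by rewrite -natrM -intr_norm -natr_absz ler_nat mulnC leq_trunc_div.
have [|c [cb cd]] := @zdecode_surj b M _ z 0 isT (leqnn _).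
  move=> j; rewrite /z; case: ifP => [jm _|]; last by rewrite eqxx.
  exact: leq_trans jm mU.
exists k, c; rewrite gE; split.
- apply: (leq_trans cb); apply: leq_trans (code_bound he emE E0 N1).
  by rewrite leq_mul2l leq_pexp2l ?orbT // muln_gt0.
- move=> j jm; rewrite cd /z jm.
  exact: truncate_bounds.
- have gr : 1 <= g%:R :> R by rewrite ler1n.
  rewrite -[(Posz g)%:~R]/(g%:R : R).
  have me : m%:R <= 3 * L / e * N.+1%:R.
    rewrite mulrAC ler_pdivlMr //; lra.
  have c0 : 0 <= 3 * L / e by rewrite divr_ge0 ?ltW.
  case: k hk kmin @g g0 gE gr {z zabs zS cb cd} => [|k] hk kmin g g0 gE gr.
    rewrite subrr powR0 ?gt_eqF // mulr0 mulr_ge0 ?psum_ge0 //.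
    by rewrite mulr_ge0 ?powR_ge0.
  have hk' : (2 ^+ k) `^ p * N.+1%:R <= psum p m X.
    by rewrite leNgt; apply/negP => /kmin; rewrite ltnn.
  have h1 : (g%:R - 1) `^ p <= 2 `^ p * (2 ^+ k) `^ p :> R.
    rewrite -powRM ?exprn_ge0 //; apply: ler_powRl; [lra|lra|].
    by rewrite /g natrX exprS; lra.
  apply: le_trans (_ : (3 * L / e * N.+1%:R) * (2 `^ p * (2 ^+ k) `^ p) <= _).
    by apply: ler_pM; rewrite ?powR_ge0.
  rewrite [X in X <= _](_ : _ = 2 `^ p * (3 * L / e) * ((2 ^+ k) `^ p * N.+1%:R)); last by ring.
  by rewrite ler_wpM2l // mulr_ge0 ?powR_ge0.
- case: k hk kmin @g g0 gE {z zabs zS cb cd} => [|k] hk kmin g g0 gE; first by left.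
  right; rewrite /= leNgt; apply/negP => h.
  have /kmin : psum p m X < (2 ^+ k) `^ p * N.+1%:R.
    by apply: lt_le_trans h _; rewrite ler_peMr ?powR_ge0 // ler1n.
  by rewrite ltnn.
Qed.

End Code.

(** * Quality of the best candidate *)

Lemma entry_ord n m (A : 'M[rat]_(n, m)) (i : 'I_n) (j : 'I_m) : entry A i j = A i j.
Proof. by rewrite /entry !valK. Qed.

Lemma entry_row m (v : 'rV[rat]_m) (j : 'I_m) : entry v 0 j = v ord0 j.
Proof. exact: (entry_ord v ord0 j). Qed.

Definition in_lattice n m (B : 'M[rat]_(n, m)) (v : 'rV[rat]_m) : Prop :=
  exists z : 'rV[int]_n, v = map_mx intr z *m B.

Lemma in_lattice0 n m (B : 'M[rat]_(n, m)) : in_lattice B 0.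
Proof.
exists 0; rewrite (_ : map_mx _ _ = 0) ?mul0mx //.
by apply/matrixP => i j; rewrite !mxE.
Qed.

Definition rescale (D : int) (x : rat) : int := (numq x * D %/ denq x)%Z.

Lemma denq_dvd (D a : int) (x : rat) : D%:~R * x = a%:~R -> (denq x %| D)%Z.
Proof.
move=> h; have : (D * numq x = a * denq x)%R.
  by apply: (@intr_inj rat); rewrite !intrM -h numqE mulrA.
move=> e; rewrite -(@Gauss_dvdzl _ _ (numq x)); last first.
  by rewrite coprimez_sym /coprimez /gcdz; have := coprime_num_den x; rewrite /coprime => /eqP ->.
by rewrite e dvdz_mull.
Qed.

Lemma rescaleE (D a : int) (x : rat) : D%:~R * x = a%:~R -> rescale D x = a.
Proof.
move=> h; have dD := denq_dvd h; apply: (@intr_inj rat); rewrite -h.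
apply: (mulIf (x := (denq x)%:~R)); first by rewrite intr_eq0 denq_neq0.
by rewrite -intrM /rescale divzK ?dvdz_mull // intrM numqE; ring.
Qed.

Lemma numq_le_rescale (D a : int) (x : rat) : 0 < D -> D%:~R * x = a%:~R -> `|numq x| <= `|a|.
Proof.
move=> D0 h; have : (D * numq x = a * denq x)%R.
  by apply: (@intr_inj rat); rewrite !intrM -h numqE mulrA.
have /dvdzP[k kD] := denq_dvd h; have d0 := denq_gt0 x.
move: (denq x) (numq x) kD d0 => d n kD d0 e.
have k0 : 0 < k by nia.
have -> : a = k * n by apply: (mulIf (lt0r_neq0 d0)); rewrite -e kD; ring.
rewrite normrM; nia.
Qed.

Lemma in_lattice_integral n m (B : 'M[rat]_(n, m)) (D : int) (v : 'rV[rat]_m) :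
  (forall i j, exists a : int, D%:~R * B i j = a%:~R) -> in_lattice B v ->
  forall j, exists a : int, D%:~R * v ord0 j = a%:~R.
Proof.
move=> hB [z ->] j; pose a i := projT1 (cid (hB i j)).
exists (\sum_i z ord0 i * a i); rewrite mxE mulr_sumr rmorph_sum /=.
apply: eq_bigr => i _; rewrite mxE intrM /a.
by case: (cid _) => /= k <-; ring.
Qed.

Section Approximation.
Variable R : realType.
Implicit Types (p : R) (q : \bar R).

Notation toR := (map_mx (ratr : rat -> R)).

Lemma map_ratr_intr n (z : 'rV[int]_n) : toR (map_mx intr z) = map_mx intr z.
Proof. by apply/matrixP => i j; rewrite !mxE ratr_int. Qed.

Lemma lattice_ratr n m (B : 'M[rat]_(n, m)) (v : 'rV[rat]_m) :
  lattice (toR B) (toR v) <-> in_lattice B v.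
Proof.
split=> -[z hz]; exists z; last by rewrite hz map_mxM map_ratr_intr.
by apply: (@map_mx_inj _ _ (ratr : {rmorphism rat -> R})); rewrite hz map_mxM map_ratr_intr.
Qed.

Lemma lattice_rational n m (B : 'M[rat]_(n, m)) (x : 'rV[R]_m) :
  lattice (toR B) x -> exists2 v, in_lattice B v & x = toR v.
Proof.
move=> [z ->]; exists (map_mx intr z *m B); first by exists z.
by rewrite map_mxM map_ratr_intr.
Qed.

Lemma has_inf_dist q n m (B : 'M[rat]_(n, m)) (t : 'rV[R]_m) :
  has_inf [set lpnorm q (x - t) | x in lattice (toR B)]%classic.
Proof.
split; last by exists 0 => _ [x _ <-]; exact: lpnorm_ge0.
exists (lpnorm q (0 - t)), 0 => //.
have -> : (0 : 'rV[R]_m) = toR 0 by rewrite map_mx0.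
by apply/lattice_ratr; exact: in_lattice0.
Qed.

Lemma dist_ge0 q n m (B : 'M[rat]_(n, m)) (t : 'rV[R]_m) : 0 <= dist q t (lattice (toR B)).
Proof.
apply: lb_le_inf; first by have [] := has_inf_dist q B t.
by move=> _ [x _ <-]; exact: lpnorm_ge0.
Qed.

Lemma dist_le q n m (B : 'M[rat]_(n, m)) (t : 'rV[R]_m) (x : 'rV[rat]_m) : in_lattice B x ->
  dist q t (lattice (toR B)) <= lpnorm q (toR x - t).
Proof.
move=> xB; apply: ge_inf; first by have [] := has_inf_dist q B t.
by exists (toR x) => //; exact/lattice_ratr.
Qed.

Lemma psum_scale p m (u : 'rV[R]_m) (X : nat -> int) (D : int) : 0 < D ->
  (forall j : 'I_m, D%:~R * u ord0 j = (X j)%:~R) ->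
  psum p m X = D%:~R `^ p * \sum_j `|u ord0 j| `^ p.
Proof.
move=> D0 h; rewrite /psum mulr_sumr; apply: eq_bigr => j _.
rewrite -h normrM powRM //; congr (_ `^ _ * _).
by rewrite ger0_norm // ler0z ltW.
Qed.

Lemma score_le_psum p m x : 1 <= p -> (score p m x)%:~R <= psum p m x.
Proof.
move=> p1; rewrite rmorph_sum; apply: ler_sum => j _.
by have [] := score1_bounds (x j) p1.
Qed.

Lemma psum_le_score p m x : 1 <= p ->
  psum p m x <= 4 * 2 `^ (p / 2) * (score p m x)%:~R.
Proof.
move=> p1; rewrite rmorph_sum mulr_sumr; apply: ler_sum => j _.
by have [] := score1_bounds (x j) p1.
Qed.

Lemma psum_le_sum p m (x : nat -> int) (A : R) : 1 <= p ->
  \sum_(j < m) `|(x j)%:~R| <= A -> psum p m x <= A `^ p.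
Proof.
move=> p1 hA.
have xA (j : 'I_m) : `|(x j)%:~R| <= A.
  by apply: le_trans hA; rewrite (bigD1 j) //= lerDl sumr_ge0.
have s0 : 0 <= \sum_(j < m) `|(x j)%:~R| :> R by exact: sumr_ge0.
have A0 : 0 <= A by exact: le_trans hA.
have p10 : 0 < p by lra.
rewrite -(mulr_powRB1 A0 p10).
apply: le_trans (_ : (\sum_(j < m) `|(x j)%:~R|) * A `^ (p - 1) <= _); last first.
  by rewrite ler_wpM2r ?powR_ge0.
rewrite mulr_suml; apply: ler_sum => j _.
rewrite -[X in X <= _](mulr_powRB1 _ p10) //.
by rewrite ler_wpM2l // ler_powRl //; lra.
Qed.

Lemma psumD_le p m (x y : nat -> int) : 1 <= p ->
  psum p m (fun j => x j + y j) <= 2 `^ p * (psum p m x + psum p m y).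
Proof.
move=> p1; rewrite /psum -big_split /= mulr_sumr; apply: ler_sum => j _.
apply: le_trans (powRD_le p1 (normr_ge0 _) (normr_ge0 _)).
by apply: ler_powRl; rewrite ?intrD ?ler_normD //; lra.
Qed.

Lemma near_closest p n m (B : 'M[rat]_(n, m)) (t : 'rV[rat]_m) (D : int) :
  1 <= p -> 0 < D ->
  (forall i j, exists a : int, D%:~R * B i j = a%:~R) ->
  (forall j, exists a : int, D%:~R * t ord0 j = a%:~R) ->
  exists2 x, in_lattice B x &
    lpnorm p%:E (toR x - toR t) <= 11 / 10 * dist p%:E (toR t) (lattice (toR B)).
Proof.
move=> p1 D0 hB ht; have p0 : 0 < p by lra.
have d0 := dist_ge0 p%:E B (toR t).
have D0r : 0 < D%:~R :> R by rewrite ltr0z.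
move: d0; rewrite le_eqVlt => /predU1P[d0|d0].
  have [|_ [x /lattice_rational[v vB ->] <-]] :=
    @inf_adherent _ _ (D%:~R^-1) _ (has_inf_dist p%:E B (toR t)); first by rewrite invr_gt0.
  rewrite -/(dist p%:E (toR t) (lattice (toR B))) -d0 add0r => lt.
  exists v => //.
  rewrite mulr0.
  have h := lpnorm_powR (toR v - toR t) p1.
  suff z j : (toR v - toR t) ord0 j = 0.
    have : lpnorm p%:E (toR v - toR t) `^ p = 0.
      by rewrite h big1 // => j _; rewrite z normr0 powR0 // gt_eqF.
    by move=> /powR_eq0_eq0 ->.
  have lj : `|(toR v - toR t) ord0 j| < D%:~R^-1.
    apply: le_lt_trans lt; rewrite leNgt; apply/negP => lt'.
    have := ltr_powRl p0 (lpnorm_ge0 _ _) lt'.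
    rewrite h (bigD1 j) //= -subr_gt0 opprD addrA subrr add0r oppr_gt0 ltNge sumr_ge0 //.
  have [a ha] := in_lattice_integral hB vB j; have [c hc] := ht j.
  have e : D%:~R * (toR v - toR t) ord0 j = (a - c)%:~R.
    rewrite !mxE -rmorphB -(ratr_int R D) -rmorphM /= mulrBr ha hc -intrB.
    by rewrite ratr_int.
  have : `|(a - c)%:~R| < 1 :> R.
    rewrite -e normrM ger0_norm ?ltW // -(ltr_pM2l D0r) in lj *.
    by move: lj; rewrite divff // gt_eqF.
  rewrite -intr_norm -[1]/(1%:~R) ltr_int => ac.
  have {}ac : a - c = 0 by lia.
  by move: e; rewrite ac => /eqP; rewrite mulf_eq0 gt_eqF //= => /eqP.
have [|_ [x /lattice_rational[v vB ->] <-] lt] :=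
    @inf_adherent _ _ (dist p%:E (toR t) (lattice (toR B)) / 10) _ (has_inf_dist p%:E B (toR t)).
  by rewrite divr_gt0.
by exists v => //; move: lt; rewrite -/(dist p%:E (toR t) (lattice (toR B))); lra.
Qed.

Definition query_target m (D : int) (T z : nat -> int) (g : int) : 'rV[rat]_m :=
  \row_j ((T j + g * z j)%:~R / D%:~R).

Lemma const_bound p (r : R) : 1 <= p -> 1 <= r ->
  4 * 2 `^ (p / 2) * (2 `^ p * (2 `^ p * (3 * r) + 1)) * (11 / 10) `^ p <= 100 `^ p * r.
Proof.
move=> p1 r1; have p0 : 0 <= p by lra.
have h2 : 2 <= 2 `^ p :> R by apply: le1r_powR; lra.
have h14 : 14 <= 14 `^ p :> R by apply: le1r_powR; lra.
have h57 : 2 `^ (p / 2) * (2 `^ p * 2 `^ p) <= (57 / 10) `^ p :> R.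
  have -> : 2 `^ (p / 2) * (2 `^ p * 2 `^ p) = (2 `^ (5 / 2)) `^ p :> R.
    rewrite -!powRD ?pnatr_eq0 ?implybT // -powRrM; congr (_ `^ _); lra.
  apply: ler_powRl; rewrite ?powR_ge0 //.
  have : (2 `^ (5 / 2)) ^+ 2 <= (57 / 10) ^+ 2 :> R.
    rewrite -powR_mulrn ?powR_ge0 // -powRrM divfK // (powR_mulrn 5) //; lra.
  by rewrite ler_pXn2r ?nnegrE ?powR_ge0 //; lra.
have -> : 100 `^ p * r = 14 `^ p * (57 / 10) `^ p * (11 / 10) `^ p
    * (100 / (14 * (57 / 10) * (11 / 10))) `^ p * r :> R.
  rewrite -!powRM; try lra; congr (_ `^ _ * _); lra.
have h1 : 1 <= (100 / (14 * (57 / 10) * (11 / 10))) `^ p :> R.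
  by apply: le_trans (_ : 1 `^ p <= _); [rewrite powR1|apply: ler_powRl; lra].
have a0 : 0 < (11 / 10) `^ p :> R by apply: powR_gt0; lra.
have hr : 2 `^ p * (3 * r) + 1 <= 2 `^ p * (7 / 2 * r) by nra.
apply: le_trans (_ : 14 `^ p * (57 / 10) `^ p * (11 / 10) `^ p * r <= _); last first.
  rewrite ler_wpM2r ?ler_peMr ?mulr_ge0 ?powR_ge0 //; lra.
rewrite [X in _ <= X]mulrAC ler_wpM2r ?(ltW a0) //.
apply: le_trans (_ : 14 * (2 `^ (p / 2) * (2 `^ p * 2 `^ p)) * r <= _).
  have c0 : 0 <= 4 * 2 `^ (p / 2) * 2 `^ p :> R by rewrite !mulr_ge0 ?powR_ge0.
  have := ler_wpM2l c0 hr; lra.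
rewrite ler_wpM2r //; first lra.
by apply: ler_pM => //; rewrite !mulr_ge0 ?powR_ge0.
Qed.

End Approximation.

Lemma norm_le_sqr (a : int) : `|a| <= a * a.
Proof. by case: (ler0P a) => h; nia. Qed.

Section Quality.
Variable R : realType.
Implicit Types (p : R) (q : \bar R).

Notation toR := (map_mx (ratr : rat -> R)).

Lemma psum_overlong p m (D : int) (v : 'rV[rat]_m) (T V : nat -> int) (W : int) :
  1 <= p -> 0 < D -> (forall j : 'I_m, D%:~R * v ord0 j = (V j)%:~R) ->
  W = 2 * \sum_(j < m) T j * T j ->
  (exists2 j, (j < m)%N & W < `|numq (entry v 0 j)|) ->
  psum p m (fun j => - T j) <= psum p m (fun j => V j - T j).
Proof.
move=> p1 D0 hV hW [j jm hj]; have p0 : 0 <= p by lra.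
pose A : int := \sum_(j < m) T j * T j.
have TA : \sum_(j < m) `|(- T j)%:~R| <= A%:~R :> R.
  rewrite rmorph_sum; apply: ler_sum => i _.
  by rewrite -intr_norm ler_int normrN norm_le_sqr.
have jA : `|T j| <= A.
  rewrite /A (bigD1 (Ordinal jm)) //=.
  have : 0 <= \sum_(i < m | i != Ordinal jm) T i * T i.
    by apply: sumr_ge0 => i _; rewrite -expr2 sqr_ge0.
  by move=> h; rewrite (le_trans (norm_le_sqr (T j))) // lerDl.
have hWA : W = 2 * A by [].
move: A TA jA hWA => A TA jA hWA.
apply: le_trans (psum_le_sum p1 TA) _.
rewrite /psum (bigD1 (Ordinal jm)) //=.
apply: le_trans (_ : `|(V j - T j)%:~R| `^ p <= _); last first.
  by rewrite lerDl; apply: sumr_ge0 => i _; exact: powR_ge0.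
have A0 : 0 <= A by lia.
apply: ler_powRl; rewrite ?ler0z // -intr_norm ler_int.
have := numq_le_rescale D0 (hV (Ordinal jm)).
rewrite -(entry_row v (Ordinal jm)) /=; lia.
Qed.

Lemma approximation p q n m (B : 'M[rat]_(n, m)) (t : 'rV[rat]_m)
    (D : int) (T best : nat -> int) (e c0 : R) (E : nat) (W : int)
    (b := (2 * m %/ E).+1) :
  1 <= p -> (p%:E < q)%E -> 0 < e < 1 / 100 -> 1 <= c0 ->
  e * m%:R <= E%:R -> (0 < E)%N -> 0 < D ->
  (forall i j, exists a : int, D%:~R * B i j = a%:~R) ->
  (forall j : 'I_m, D%:~R * t ord0 j = (T j)%:~R) ->
  W = 2 * \sum_(j < m) T j * T j ->
  score p m (fun j => best j - T j) <= score p m (fun j => - T j) ->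
  (forall k c, 2 ^+ k < 2 * W + 2 -> (c < 2 ^ E)%N ->
     exists v : 'rV[rat]_m,
     let t' := query_target m D T (zdecode b c 0) (2 ^+ k) in
     [/\ in_lattice B v,
         lpnorm q (toR v - toR t') <= c0 * dist q (toR t') (lattice (toR B))
       & (exists2 j, (j < m)%N & W < `|numq (entry v 0 j)|) \/
         score p m (fun j => best j - T j) <=
           score p m (fun j => rescale D (entry v 0 j) - T j)]) ->
  lpnorm p%:E (toR (\row_j ((best j)%:~R / D%:~R)) - toR t) <=
    100 * log2 (1 / e) `^ p^-1 / e `^ p^-1 * c0 * dist p%:E (toR t) (lattice (toR B)).
Proof.
move=> p1 pq he c1 emE E0 D0 hB ht hW best0 cov.
have p0 : 0 < p by lra.
have /andP[e0 e1] := he.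
have c00 : 0 <= c0 by lra.
have c0_gt0 : 0 < c0 by lra.
have L1 := log2_inv_ge1 he; set L := log2 (1 / e) in L1 *.
have D0r : 0 < D%:~R :> R by rewrite ltr0z.
have [//|x xB hx] := near_closest p1 D0 hB (t := t); first by move=> j; exists (T j).
set d := dist _ _ _ in hx *.
have d0 : 0 <= d by exact: dist_ge0.
have hxD j : exists a : int, D%:~R * x ord0 j = a%:~R := in_lattice_integral hB xB j.
pose Vx (j : nat) : int := rescale D (entry x 0 j).
have hVx (j : 'I_m) : D%:~R * x ord0 j = (Vx j)%:~R.
  by have [a ha] := hxD j; rewrite /Vx entry_row (rescaleE ha).
pose X j := Vx j - T j.
have hX (j : 'I_m) : D%:~R * (toR x - toR t) ord0 j = (X j)%:~R.
  rewrite !mxE -rmorphB -(ratr_int R D) -rmorphM /= mulrBr hVx ht -intrB.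
  by rewrite ratr_int.
have h11 : 0 <= 11 / 10 :> R by lra.
have NX : psum p m X <= D%:~R `^ p * ((11 / 10) `^ p * d `^ p).
  rewrite (psum_scale _ D0 hX) ler_pM2l ?powR_gt0 // -lpnorm_powR // -(powRM _ h11 d0).
  by apply: ler_powRl; rewrite ?lpnorm_ge0 // ltW.
have NX0 := psum_ge0 p m X.
have [k [c [cE hz hm hk]]] := exists_code X p1 he emE E0.
rewrite -/L in hm; set g : int := 2 ^+ k in hz hm.
have gk : 2 ^+ k < 2 * W + 2.
  pose A : int := \sum_(j < m) T j * T j.
  have A0 : 0 <= A by apply: sumr_ge0 => j _; rewrite -expr2 sqr_ge0.
  have TA : \sum_(j < m) `|(- T j)%:~R| <= A%:~R :> R.
    by rewrite rmorph_sum; apply: ler_sum => i _; rewrite -intr_norm ler_int normrN norm_le_sqr.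
  have hWA : W = 2 * A by [].
  move: A A0 TA hWA => A A0 TA hWA.
  case: hk => [->|hk].
    by rewrite expr0 hWA; move: A0; clear; lia.
  have NT : D%:~R `^ p * d `^ p <= A%:~R `^ p.
    apply: le_trans (@psum_le_sum _ p m (fun j => - T j) _ p1 TA).
    have h0 (j : 'I_m) : D%:~R * (toR 0 - toR t) ord0 j = (- T j)%:~R.
      rewrite !mxE -rmorphB -(ratr_int R D) -rmorphM /= mulrBr ht mulr0 sub0r -mulrNz.
      by rewrite ratr_int.
    rewrite (@psum_scale _ p m _ (fun j => - T j) _ D0 h0) ler_pM2l ?powR_gt0 // -lpnorm_powR //.
    by apply: ler_powRl; rewrite ?(ltW p0) //; apply: dist_le; exact: in_lattice0.
  have : (2 ^+ k.-1) `^ p <= (11 / 10 * A%:~R) `^ p.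
    apply: le_trans hk _; apply: le_trans NX _; rewrite (powRM _ h11) ?ler0z //.
    by rewrite mulrCA ler_wpM2l ?powR_ge0.
  have k1 : 2 ^+ k <= 2 * 2 ^+ k.-1 :> int.
    by case: (k) => [|k'] /=; rewrite ?expr0 ?exprS.
  rewrite leNgt => /negP h; rewrite hWA ltNge; apply/negP => h'; apply: h.
  apply: ltr_powRl => //; first by rewrite mulr_ge0 ?ler0z //; lra.
  have : 2 * A + 1 <= 2 ^+ k.-1 by move: (2 ^+ k) (2 ^+ k.-1) h' k1; clear; lia.
  rewrite -(ler_int R) rmorphD rmorphM rmorphXn /= => h2.
  apply: lt_le_trans h2; have : 0 <= A%:~R :> R by rewrite ler0z.
  lra.
have [v [vB vq vcov]] := cov k c gk cE.
set t' := query_target _ _ _ _ _ in vq.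
have hVv (j : 'I_m) : D%:~R * v ord0 j = (rescale D (entry v 0 j))%:~R.
  by have [a ha] := in_lattice_integral hB vB j; rewrite entry_row (rescaleE ha).
pose z := zdecode b c 0.
have D0q : D%:~R != 0 :> rat by rewrite intr_eq0 gt_eqF.
have ht' (j : 'I_m) : D%:~R * t' ord0 j = (T j + g * z j)%:~R.
  by rewrite mxE mulrCA divff ?mulr1.
have g1 : 1 <= g.
  by rewrite /g; apply: exprn_ege1.
have g1r : 0 <= g%:~R - 1 :> R by rewrite subr_ge0 -[1]/(1%:~R) ler_int.
have oracle_error : lpnorm q (toR v - toR t') <= unit_lpnorm q m * (c0 * ((g%:~R - 1) / D%:~R)).
  apply: le_trans vq _; rewrite mulrCA ler_pM2l //.
  apply: le_trans (dist_le q (toR t') xB) _; apply: lpnorm_le.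
  - by apply: le_trans (ltW pq); rewrite lee_fin.
  - by rewrite divr_ge0 // ltW.
  - move=> j; rewrite ler_pdivlMr // mulrC -[in X in X <= _](gtr0_norm D0r) -normrM.
    have -> : D%:~R * (toR x - toR t') ord0 j = (X j - g * z j)%:~R.
      rewrite !mxE -rmorphB -(ratr_int R D) -rmorphM /= mulrBr hVx.
      have := ht' j; rewrite mxE => ->; rewrite -intrB ratr_int; congr _%:~R.
      by rewrite /X; ring.
    rewrite -intr_norm -[1]/(1%:~R) -intrB ler_int.
    by have [] := hz j (ltn_ord j).
pose r := c0 `^ p * (L / e).
have cp1 : 1 <= c0 `^ p by exact: le_trans c1 (le1r_powR c1 p1).
have Le1 : 1 <= L / e by rewrite ler_pdivlMr // mul1r; apply: le_trans L1; move: e1; clear; lra.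
have r1 : 1 <= r by rewrite /r -[1]mulr1 ler_pM.
have Nv : psum p m (fun j => rescale D (entry v 0 j) - T j) <=
    2 `^ p * (2 `^ p * (3 * r) + 1) * psum p m X.
  pose Y (j : nat) := rescale D (entry v 0 j) - T j - g * z j.
  have -> : psum p m (fun j => rescale D (entry v 0 j) - T j) = psum p m (fun j => Y j + g * z j).
    by apply: eq_bigr => j _; rewrite /Y subrK.
  apply: le_trans (psumD_le _ _ _ p1) _; rewrite -mulrA ler_pM2l ?powR_gt0 //.
  rewrite mulrDl mul1r; apply: lerD; last first.
    apply: ler_sum => j _; apply: ler_powRl => //; first exact: ltW.
    rewrite -!intr_norm ler_int; by have [] := hz j (ltn_ord j).
  have hY (j : 'I_m) : D%:~R * (toR v - toR t') ord0 j = (Y j)%:~R.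
    rewrite !mxE -rmorphB -(ratr_int R D) -rmorphM /= mulrBr hVv.
    have := ht' j; rewrite mxE => ->; rewrite -intrB ratr_int; congr _%:~R.
    by rewrite /Y; ring.
  rewrite (psum_scale _ D0 hY).
  have a0 : 0 <= c0 * ((g%:~R - 1) / D%:~R) by rewrite mulr_ge0 ?divr_ge0 // ltW.
  apply: le_trans (_ : D%:~R `^ p * (m%:R * (c0 * ((g%:~R - 1) / D%:~R)) `^ p) <= _).
    by rewrite ler_wpM2l ?powR_ge0 //; apply: sum_powR_le p1 pq a0 oracle_error.
  rewrite mulrCA -powRM ?(ltW D0r) //.
  have -> : D%:~R * (c0 * ((g%:~R - 1) / D%:~R)) = c0 * (g%:~R - 1).
    by rewrite mulrCA [D%:~R * _]mulrC divfK // gt_eqF.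
  rewrite powRM // mulrCA.
  apply: le_trans (ler_wpM2l (powR_ge0 c0 p) hm) _.
  by rewrite /r le_eqVlt; apply/orP; left; apply/eqP; ring.
have Nb : psum p m (fun j => best j - T j) <=
    4 * 2 `^ (p / 2) * (2 `^ p * (2 `^ p * (3 * r) + 1) * psum p m X).
  apply: le_trans (psum_le_score _ _ p1) _; rewrite ler_pM2l ?mulr_gt0 ?powR_gt0 //.
  apply: le_trans Nv.
  case: vcov => [ov|sc].
    apply: le_trans (psum_overlong p1 D0 hVv hW ov).
    by apply: le_trans (score_le_psum _ _ p1); rewrite ler_int.
  by apply: le_trans (score_le_psum _ _ p1); rewrite ler_int.
set u : 'rV[rat]_m := \row_j _.
have hu (j : 'I_m) : D%:~R * (toR u - toR t) ord0 j = (best j - T j)%:~R.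
  rewrite !mxE -rmorphB -(ratr_int R D) -rmorphM /= mulrBr ht mulrCA divff // mulr1 -intrB.
  by rewrite ratr_int.
have main : lpnorm p%:E (toR u - toR t) `^ p <= 100 `^ p * r * d `^ p.
  rewrite lpnorm_powR // -(ler_pM2l (powR_gt0 p D0r)).
  rewrite -(@psum_scale _ p m _ (fun j => best j - T j) _ D0 hu).
  apply: le_trans Nb _.
  set K := 2 `^ p * (2 `^ p * (3 * r) + 1).
  have K0 : 0 <= 4 * 2 `^ (p / 2) * K.
    have r0 : 0 <= r := le_trans ler01 r1.
    have K0 : 0 <= K by rewrite mulr_ge0 ?powR_ge0 // addr_ge0 // mulr_ge0 ?powR_ge0 // mulr_ge0.
    by apply: mulr_ge0 K0; apply: mulr_ge0; rewrite ?powR_ge0.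
  rewrite mulrA; apply: le_trans (ler_wpM2l K0 NX) _.
  have dp0 : 0 <= D%:~R `^ p * d `^ p by rewrite mulr_ge0 ?powR_ge0.
  rewrite [X in X <= _](_ : _ =
    4 * 2 `^ (p / 2) * K * (11 / 10) `^ p * (D%:~R `^ p * d `^ p)); last by ring.
  rewrite [X in _ <= X](_ : _ = 100 `^ p * r * (D%:~R `^ p * d `^ p)); last by ring.
  by rewrite ler_wpM2r // /K const_bound.
have p10 : 0 <= p^-1 by rewrite invr_ge0 ltW.
have := ler_powRl p10 (powR_ge0 _ _) main.
have L0 : 0 <= L := le_trans ler01 L1.
rewrite -powRrM divff ?gt_eqF // powRr1 ?lpnorm_ge0 // => /le_trans; apply.
have root (s : R) : 0 <= s -> (s `^ p) `^ p^-1 = s.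
  by move=> r0; rewrite -powRrM divff ?gt_eqF // powRr1.
have eV0 : 0 <= e^-1 by rewrite invr_ge0 ltW.
have eV : e^-1 `^ p^-1 = (e `^ p^-1)^-1.
  by rewrite -(powR_inv1 (ltW e0)) powRAC powR_inv1 ?powR_ge0.
have c100 : 0 <= 100 :> R by [].
have Le0 : 0 <= L / e by rewrite mulr_ge0.
have r0 : 0 <= r by rewrite mulr_ge0 ?powR_ge0.
rewrite [X in X <= _](powRM _ (mulr_ge0 (powR_ge0 _ _) r0) (powR_ge0 _ _)) (root d) //.
rewrite [X in X * d <= _](powRM _ (powR_ge0 _ _) r0) (root _ c100).
rewrite /r (powRM _ (powR_ge0 _ _) Le0) (root _ c00) (powRM _ L0 eV0) eV.
by rewrite le_eqVlt; apply/orP; left; apply/eqP; ring.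
Qed.

End Quality.

(** * The program and its verification *)

Notation rN := 0%N (only parsing).
Notation rM := 1%N (only parsing).
Notation rD := 2%N (only parsing).
Notation rW := 3%N (only parsing).
Notation rCodes := 4%N (only parsing).
Notation rB := 5%N (only parsing).
Notation rG := 6%N (only parsing).
Notation rCode := 7%N (only parsing).
Notation rBest := 8%N (only parsing).
Notation rScore := 9%N (only parsing).
Notation rJ := 10%N (only parsing).
Notation rC := 11%N (only parsing).
Notation rPos := 12%N (only parsing).
Notation rH := 13%N (only parsing).
Notation rQ := 14%N (only parsing).
Notation rX := 15%N (only parsing).
Notation rPow := 16%N (only parsing).
Notation rLog := 17%N (only parsing).
Notation rExp := 18%N (only parsing).
Notation rTerm := 19%N (only parsing).
Notation rK := 20%N (only parsing).
Notation rE := 21%N (only parsing).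

(* Array 7 holds the target, array 8 the current answer and array 6 the best
   answer so far, all multiplied by the common denominator. *)

Definition double x := Set_reg x (Add (Reg x) (Reg x)).

Definition common_denominator :=
  Seq (Set_reg rD (Const 1))
  (Seq (For rJ (Mul (Reg rN) (Reg rM)) (Set_reg rD (Mul (Reg rD) (Arr 1 (Reg rJ)))))
       (For rJ (Reg rM) (Set_reg rD (Mul (Reg rD) (Arr 3 (Reg rJ)))))).

Definition rescale_target :=
  For rJ (Reg rM)
    (Seq (Set_arr 7 (Reg rJ) (Div (Mul (Arr 2 (Reg rJ)) (Reg rD)) (Arr 3 (Reg rJ))))
         (Set_reg rW (Add (Reg rW) (Mul (Const 2)
            (Mul (Arr 7 (Reg rJ)) (Arr 7 (Reg rJ))))))).

Definition count_codes :=
  Seq (Set_reg rPow (Const 1))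
  (Seq (For rJ (Reg rM) (double rPow))
  (Seq (Param rExp 2 (Reg rM))
  (Seq (Set_reg rE (Add (Div (Mul (Reg rExp) (Reg rM)) (Reg rPow)) (Const 2)))
  (Seq (Set_reg rCodes (Const 1))
  (Seq (For rJ (Reg rE) (double rCodes))
       (Set_reg rB (Add (Div (Mul (Const 2) (Reg rM)) (Reg rE)) (Const 1)))))))).

Definition score_coordinate :=
  Seq (Set_arr 8 (Reg rJ) (Div (Mul (Arr 4 (Reg rJ)) (Reg rD)) (Arr 5 (Reg rJ))))
  (Seq (Set_reg rX (Defs.Sub (Arr 8 (Reg rJ)) (Arr 7 (Reg rJ))))
  (Seq (Set_reg rX (Mul (Reg rX) (Reg rX)))
  (Seq (Set_reg rPow (Const 1))
  (Seq (Set_reg rLog (Const 0))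
  (Seq (While_lt (Add (Reg rPow) (Reg rPow)) (Add (Reg rX) (Const 1))
          (Seq (double rPow) (Set_reg rLog (Add (Reg rLog) (Const 1)))))
  (Seq (Param rExp 0 (Reg rLog))
  (Seq (Set_reg rExp (Div (Mul (Reg rExp) (Reg rLog)) (Mul (Const 2) (Reg rPow))))
  (Seq (Set_reg rTerm (Div (Reg rX) (Reg rX)))
  (Seq (For rK (Reg rExp) (double rTerm))
       (Set_reg rScore (Add (Reg rScore) (Reg rTerm)))))))))))).

Definition reject := Set_reg rScore (Add (Add (Reg rScore) (Reg rBest)) (Const 1)).

(* The numerators are compared with the bound W in rW before being read; a
   rejected answer gets a score above the best one. *)
Definition score_answer :=
  Seq (Set_reg rScore (Const 0))
  (For rJ (Reg rM)
    (If_lt (Arr 4 (Reg rJ)) (Add (Reg rW) (Const 1))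
      (If_lt (Defs.Sub (Const (-1)) (Reg rW)) (Arr 4 (Reg rJ)) score_coordinate reject)
      reject)).

Definition add_unit_entry :=
  Seq (Set_reg rQ (Div (Reg rH) (Reg rB)))
  (Seq (Set_reg rE (Add (Reg rPos) (Defs.Sub (Reg rH) (Mul (Reg rB) (Reg rQ)))))
  (Seq (If_lt (Reg rE) (Reg rM)
          (Set_arr 2 (Reg rE) (Add (Arr 2 (Reg rE)) (Mul (Reg rG)
             (Add (Const 1) (Defs.Sub (Mul (Const 4) (Div (Reg rQ) (Const 2)))
                                      (Mul (Const 2) (Reg rQ)))))))
          Skip)
       (Set_reg rC (Div (Reg rQ) (Const 2))))).

Definition add_code :=
  While_lt (Const 0) (Reg rC)
    (Seq (Set_reg rH (Div (Reg rC) (Const 2)))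
    (If_lt (Add (Reg rH) (Reg rH)) (Reg rC)
      add_unit_entry
      (Seq (Set_reg rC (Reg rH)) (Set_reg rPos (Add (Reg rPos) (Reg rB)))))).

Definition try_code :=
  Seq (For rJ (Reg rM)
         (Seq (Set_arr 2 (Reg rJ) (Arr 7 (Reg rJ))) (Set_arr 3 (Reg rJ) (Reg rD))))
  (Seq (Set_reg rC (Reg rCode))
  (Seq (Set_reg rPos (Const 0))
  (Seq add_code
  (Seq Query
  (Seq score_answer
  (If_lt (Reg rScore) (Reg rBest)
    (Seq (Set_reg rBest (Reg rScore))
         (For rJ (Reg rM) (Set_arr 6 (Reg rJ) (Arr 8 (Reg rJ)))))
    Skip)))))).

Definition search :=
  Seq (Set_reg rG (Const 1))
      (While_lt (Reg rG) (Add (Mul (Const 2) (Reg rW)) (Const 2))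
        (Seq (For rCode (Reg rCodes) try_code) (double rG))).

Definition output :=
  For rJ (Reg rM)
    (Seq (Set_arr 4 (Reg rJ) (Arr 6 (Reg rJ))) (Set_arr 5 (Reg rJ) (Reg rD))).

(* The first call of [score_answer] sees the zero vector, as 0 / 0. *)
Definition reduction :=
  Seq common_denominator
  (Seq rescale_target
  (Seq count_codes
  (Seq score_answer
  (Seq (Set_reg rBest (Reg rScore))
  (Seq search output))))).

Lemma sum_ord_le (f : nat -> nat) i N : (i <= N)%N ->
  (\sum_(k < i) f k <= \sum_(k < N) f k)%N.
Proof.
move=> iN; rewrite (big_ord_widen N f iN) big_mkcond.
by apply: leq_sum => k _; case: ifP.
Qed.

Lemma prod_bitlen (f : nat -> int) i : (forall k, 0 < f k) ->
  0 < \prod_(k < i) f k /\ (`|(\prod_(k < i) f k)%R| <= 2 ^ \sum_(k < i) bitlen (f k))%N.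
Proof.
move=> f0; elim: i => [|i [ih1 ih2]]; first by rewrite !big_ord0.
rewrite !big_ord_recr /= mulr_gt0 //; split=> //.
by rewrite abszM expnD leq_mul // ltnW // ltn_exp_bitlen.
Qed.

Lemma expS_split i j s : (2 ^ ((i + j) * s) = 2 ^ (i * s) * 2 ^ (j * s))%N.
Proof. by rewrite mulnDl expnD. Qed.

Lemma expS_le i j s : (i <= j)%N -> (2 ^ (i * s) <= 2 ^ (j * s))%N.
Proof. by move=> ij; rewrite leq_exp2l // leq_mul2r ij orbT. Qed.

Lemma expS_double i j s : (0 < s)%N -> (i < j)%N -> (2 * 2 ^ (i * s) <= 2 ^ (j * s))%N.
Proof. by move=> s0 ij; rewrite -expnS leq_exp2l // ltn_pmul2r. Qed.

Lemma absz_mul_lt (u v : int) (x z : nat) : (`|u| < x)%N -> (`|v| < z)%N ->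
  (`|(u * v)%R| < x * z)%N.
Proof. by move=> h1 h2; rewrite abszM ltn_mul. Qed.

Lemma absz_add_lt (u v : int) (x z : nat) : (`|u| < x)%N -> (`|v| < x)%N ->
  (2 * x <= z)%N -> (`|(u + v)%R| < z)%N.
Proof. lia. Qed.

Lemma exp2_double k : 2 ^+ k + 2 ^+ k = 2 ^+ k.+1 :> int.
Proof. by rewrite exprS mulr_natl mulr2n. Qed.

Lemma score_room (k x : nat) (c best : int) : (k.+1 <= x)%N -> 1 <= c -> best <= k%:Z * c ->
  k.+1%:Z * (c + best + 1) <= (x * (2 * x))%N%:Z * c.
Proof.
move=> kx c1 hb; apply: (@le_trans _ _ (k.+1%:Z * (k.+2%:Z * c))).
  by rewrite ler_wpM2l //; lia.
rewrite mulrA ler_wpM2r -?PoszM ?lez_nat ?leq_mul //; lia.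
Qed.

Lemma half_le k : (k./2 <= k)%N.
Proof. lia. Qed.

Lemma prod_den_integral (f : nat -> rat) N k : (k < N)%N ->
  exists c : int, (\prod_(i < N) denq (f i))%:~R * f k = c%:~R.
Proof.
move=> kN; exists (numq (f k) * \prod_(i < N | i != Ordinal kN) denq (f i)).
by rewrite (bigD1 (Ordinal kN)) //= !intrM numqE; ring.
Qed.

Lemma mixed_radix_ltn i j n m : (i < n)%N -> (j < m)%N -> (i * m + j < n * m)%N.
Proof. by move=> hi hj; nia. Qed.

Section Verification.
Variables (R : realType) (theta : nat -> R) (O : oracle) (w : seq bool).
Variables (I : instance) (p e : R) (a : nat).
Hypotheses (theta0 : theta 0%N = p) (theta2 : theta 2%N = e).
Hypotheses (p1 : 1 <= p) (pa : p <= a%:R) (he : 0 < e < 1 / 100) (vI : valid I).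

Let n := rk I.
Let m := dm I.
Let S := (size_of I).+1.
Let y := ((8 * a + 100) * S)%N.

Definition same_shape (J : instance) : Prop :=
  [/\ valid J, rk J = rk I & dm J = dm I].

Notation wpI := (wp theta O w y same_shape).
Notation smallI := (small y).

Let bas k := entry (Defs.basis I) (k %/ m)%N (k %% m)%N.
Let tgt k := entry (Defs.target I) 0 k.

Definition den_basis i : int := \prod_(k < i) denq (bas k).
Definition den_target i : int := den_basis (n * m) * \prod_(k < i) denq (tgt k).
Let D := den_target m.
Let T j := rescale D (tgt j).
Definition weight i : int := 2 * \sum_(j < i) T j * T j.
Let W := weight m.
Let E := (`|(Num.floor (2 ^+ m * e) * m%:Z %/ 2 ^+ m)%Z| + 2)%N.
Let b := (2 * m %/ E).+1.

Let S0 : (0 < S)%N. Proof. by []. Qed.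
Let a0 : (0 < a)%N.
Proof. by rewrite -(ltr0n R); exact: lt_le_trans (lt_le_trans ltr01 p1) pa. Qed.

Lemma small_exp v k : (`|v| < 2 ^ (k * S))%N -> (k <= 8 * a + 100)%N -> smallI v.
Proof.
by move=> h k1; apply: (leq_trans h); rewrite leq_exp2l // leq_mul2r k1 orbT.
Qed.

Lemma size_ofE : size_of I =
  (\sum_(k < n * m) (bitlen (numq (bas k)) + bitlen (denq (bas k))) +
   \sum_(k < m) (bitlen (numq (tgt k)) + bitlen (denq (tgt k))))%N.
Proof. by []. Qed.

Lemma dm_le : (m < S)%N.
Proof.
rewrite /S ltnS size_ofE; apply: leq_trans (leq_addl _ _).
rewrite -[X in (X <= _)%N]card_ord -sum1_card; apply: leq_sum => k _.
by rewrite /bitlen; lia.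
Qed.

Lemma rk_le : (n <= m)%N.
Proof. by move: vI; rewrite /valid -row_leq_rank => h; apply: leq_trans h (rank_leq_col _). Qed.

Lemma den_basis_bound i : (i <= n * m)%N -> 0 < den_basis i /\ (`|den_basis i| < 2 ^ S)%N.
Proof.
move=> ile; have [h1 h2] := @prod_bitlen (fun k => denq (bas k)) i (fun k => denq_gt0 _).
split=> //; apply: (leq_ltn_trans h2); rewrite ltn_exp2l // /S ltnS size_ofE.
apply: leq_trans (leq_addr _ _).
apply: leq_trans (sum_ord_le (fun k => bitlen (denq (bas k))) ile) _.
by apply: leq_sum => k _; exact: leq_addl.
Qed.

Lemma den_target_bound i : (i <= m)%N -> 0 < den_target i /\ (`|den_target i| < 2 ^ S)%N.
Proof.
move=> ile; have [h1 h2] := @prod_bitlen (fun k => denq (tgt k)) i (fun k => denq_gt0 _).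
have [h3 h4] := @prod_bitlen (fun k => denq (bas k)) (n * m) (fun k => denq_gt0 _).
rewrite /den_target mulr_gt0 //; split=> //.
rewrite abszM; apply: leq_ltn_trans (leq_mul h4 h2) _; rewrite -expnD ltn_exp2l // /S ltnS size_ofE.
apply: leq_add; first by apply: leq_sum => k _; exact: leq_addl.
apply: leq_trans (sum_ord_le (fun k => bitlen (denq (tgt k))) ile) _.
by apply: leq_sum => k _; exact: leq_addl.
Qed.

Lemma D_gt0 : 0 < D. Proof. by have [] := den_target_bound (leqnn m). Qed.
Lemma D_lt : (`|D| < 2 ^ S)%N. Proof. by have [] := den_target_bound (leqnn m). Qed.

Lemma numq_tgt_lt j : (j < m)%N -> (`|numq (tgt j)| < 2 ^ S)%N.
Proof.
move=> jm; apply: leq_trans (ltn_exp_bitlen _) _; rewrite leq_exp2l // /S size_ofE.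
rewrite ltnW // ltnS (bigD1 (Ordinal jm)) //=; lia.
Qed.

Lemma T_lt j : (j < m)%N -> (`|T j| < 2 ^ (2 * S))%N.
Proof.
move=> jm; rewrite /T /rescale; apply: leq_ltn_trans (absz_divz_le _ _) _.
by rewrite abszM mul2n -addnn expnD ltn_mul // ?numq_tgt_lt ?D_lt.
Qed.

Lemma S_lt : (S < 2 ^ S)%N. Proof. exact: ltn_expl. Qed.

Lemma weight_bound i : (i <= m)%N -> 0 <= weight i /\ (`|weight i| < 2 ^ (6 * S))%N.
Proof.
move=> im; have w0 : 0 <= weight i.
  by rewrite mulr_ge0 // sumr_ge0 // => j _; rewrite -expr2 sqr_ge0.
split=> //; rewrite -ltz_nat gez0_abs //.
have : \sum_(j < i) T j * T j <= \sum_(j < i) (2 ^ (4 * S))%N%:Z.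
  apply: ler_sum => j _; have jm : (j < m)%N := leq_trans (ltn_ord j) im.
  have := T_lt jm; have -> : (4 * S = 2 * S + 2 * S)%N by lia.
  rewrite expnD; move: (2 ^ _)%N (T j) => x z h; nia.
rewrite sumr_const card_ord -mulr_natr natz.
have : (i * 2 ^ (4 * S) < 2 ^ (5 * S))%N.
  have -> : (5 * S = S + 4 * S)%N by lia.
  rewrite expnD ltn_pmul2r ?expn_gt0 //.
  by apply: leq_ltn_trans im (ltn_trans dm_le S_lt).
have : (2 * 2 ^ (5 * S) <= 2 ^ (6 * S))%N by rewrite -expnS leq_exp2l //; lia.
rewrite /weight; move: (\sum_(_ < _) _) => z; move: (2 ^ (4 * S))%N (2 ^ (5 * S))%N (2 ^ (6 * S))%N.
move=> x1 x2 x3; nia.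
Qed.

Lemma W_ge0 : 0 <= W. Proof. by have [] := weight_bound (leqnn m). Qed.
Lemma W_lt : (`|W| < 2 ^ (6 * S))%N. Proof. by have [] := weight_bound (leqnn m). Qed.

Lemma y3 : (3 <= y)%N. Proof. rewrite /y; nia. Qed.
#[local] Hint Resolve y3 : core.

Lemma S_le_y : (100 * S <= y)%N. Proof. by rewrite leq_mul2r; lia. Qed.

Lemma floor_e : exists2 F : nat, Num.floor (2 ^+ m * e) = F%:Z & (F < 2 ^ m)%N.
Proof.
have /andP[e0 e1] := he.
have P0 : 0 < 2 ^+ m :> R by rewrite exprn_gt0.
have /andP[] := floor_itv (2 ^+ m * e).
have : 0 <= Num.floor (2 ^+ m * e) by rewrite floor_ge0 mulr_ge0 ?ltW.
case: (Num.floor _) => // F _ h _; exists F => //.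
rewrite -(ltr_nat R) natrX; apply: le_lt_trans h _.
by rewrite gtr_pMr //; apply: lt_trans e1 _; lra.
Qed.

Lemma E_quo : (Num.floor (2 ^+ m * e) * m%:Z %/ 2 ^+ m)%Z = (E - 2)%N%:Z.
Proof.
have [F FE _] := floor_e.
rewrite /E addnK FE gez0_abs // divz_ge0 ?exprn_gt0 //.
Qed.

Lemma E_le : (E <= m + 2)%N.
Proof.
rewrite /E leq_add2r; have [F -> Fm] := floor_e.
have -> : 2 ^+ m = (2 ^ m)%N%:Z by rewrite -natz natrX.
rewrite -PoszM divz_nat absz_nat -[X in (_ <= X)%N](mulKn m (expn_gt0 2 m)).
by rewrite leq_div2r // leq_mul2r ltnW ?orbT.
Qed.

Lemma E_bounds : e * m%:R <= E%:R <= e * m%:R + 2.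
Proof.
have /andP[e0 e1] := he.
have P0 : 0 < 2 ^+ m :> R by rewrite exprn_gt0.
have mP := natr_lt_exp2 R m.
have /andP[F1 F2] := floor_itv (2 ^+ m * e).
have [h1 h2] := @floor_div_bounds R (Num.floor (2 ^+ m * e) * m%:Z) (2 ^+ m)
  ltac:(by rewrite exprn_gt0).
rewrite E_quo in h1 h2.
have E2 : E%:R = (E - 2)%N%:R + 2 :> R by rewrite -natrD subnK // /E leq_addl.
rewrite E2; move: h1 h2; rewrite -[(Posz _)%:~R]/((E - 2)%N%:R) intrM.
rewrite -[(Posz m)%:~R]/(m%:R) rmorphXn /= => h1 h2.
rewrite intrD in F2; move: (Num.floor _)%:~R F1 F2 h1 h2 => F F1 F2 h1 h2.
rewrite ler_pdivlMr // in h1; rewrite ltr_pdivrMr // in h2.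
have m0 : 0 <= m%:R :> R by [].
have h3 : (2 ^+ m * e - 1) * m%:R <= F * m%:R by rewrite ler_wpM2r //; lra.
have h4 : F * m%:R <= 2 ^+ m * e * m%:R by rewrite ler_wpM2r.
move: (E - 2)%N%:R h1 h2 => k h1 h2.
have h5 : k * 2 ^+ m <= (e * m%:R) * 2 ^+ m by lra.
have h6 : e * m%:R * 2 ^+ m < (k + 2) * 2 ^+ m by lra.
rewrite ler_pM2r // in h5; rewrite ltr_pM2r // in h6.
by apply/andP; split; lra.
Qed.

Lemma E_gt0 : (0 < E)%N. Proof. by rewrite /E addn2. Qed.

Lemma nm_le : (n * m < S)%N.
Proof.
rewrite /S ltnS size_ofE; apply: leq_trans (leq_addr _ _).
rewrite -[X in (X <= _)%N]card_ord -sum1_card; apply: leq_sum => k _.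
by rewrite /bitlen; lia.
Qed.

Lemma m_le_y : (m <= y)%N.
Proof. by have := dm_le; have := S_le_y; lia. Qed.

Lemma E_le_S : (E <= 3 * S)%N.
Proof. by have := E_le; have := dm_le; lia. Qed.

Lemma E_le_y : (E <= y)%N.
Proof. by have := E_le_S; have := S_le_y; lia. Qed.

Lemma small_nat k : (k <= y)%N -> smallI k%:Z.
Proof. by move=> h; rewrite /small absz_nat (leq_ltn_trans h) // ltn_expl. Qed.

Lemma small0 : smallI 0. Proof. exact: (@small_nat 0). Qed.
Lemma small1 : smallI 1. Proof. by apply: (@small_nat 1); rewrite (leq_trans _ y3). Qed.
#[local] Hint Resolve small0 small1 : core.

Lemma small_pow2 k : (k < y)%N -> smallI (2 ^+ k).
Proof. by move=> h; rewrite /small abszX ltn_exp2l. Qed.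

Record ready (M : memory) : Prop := Ready {
  ready_n : mr M rN = n%:Z;
  ready_m : mr M rM = m%:Z;
  ready_D : mr M rD = D;
  ready_W : mr M rW = W;
  ready_codes : mr M rCodes = 2 ^+ E;
  ready_b : mr M rB = b%:Z;
  ready_num : forall k, ma M 0 k = numq (bas k);
  ready_den : forall k, ma M 1 k = denq (bas k);
  ready_T : forall j, (j < m)%N -> ma M 7 j = T j }.

Lemma ready_frame c M M' : frame c M M' ->
  all [predC mod_regs c] (iota 0 6) -> all [predC mod_arrs c] [:: 0; 1; 7]%N ->
  ready M -> ready M'.
Proof.
move=> [fr fa] /allP hr /allP ha [h0 h1 h2 h3 h4 h5 h6 h7 h8].
have r k : (k < 6)%N -> mr M' k = mr M k by move=> k6; apply: fr; apply: hr; rewrite mem_iota.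
have ar k : k \in [:: 0; 1; 7]%N -> ma M' k = ma M k by move=> hk; apply: fa; exact: ha.
by split; rewrite ?r ?ar.
Qed.

Lemma wp_common_denominator M :
  mr M rN = n%:Z -> mr M rM = m%:Z ->
  (forall k, ma M 1 k = denq (bas k)) -> (forall k, ma M 3 k = denq (tgt k)) ->
  wpI common_denominator (10 * y) (fun M' => mr M' rD = D) M.
Proof.
move=> hn hm h1 h3.
have mS := dm_le; have nm := rk_le; have Sy := S_le_y.
have small_D v : (`|v| < 2 ^ S)%N -> smallI v.
  by move=> h; apply: (@small_exp _ 1); rewrite ?mul1n //; lia.
apply: wp_weaken (_ : wpI _ (1 + ((n * m * 3 + 2) + (m * 3 + 2)))%N _ M) _ _;
  last by move=> M' h; exact: h.
  apply: wp_seq; apply: wp_set_reg => //=.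
  apply: wp_seq; apply: wp_frame.
  apply: (@wp_for _ _ _ _ _ _ y3 (n * m) 1 (fun k M' => mr M' rD = den_basis k)) => //=.
  - by apply: leq_ltn_trans (ltn_expl y (isT : (1 < 2)%N)); have := nm_le; lia.
  - by move=> M' [fr _]; rewrite !fr //= hn hm.
  - by rewrite /den_basis big_ord0.
  - move=> k M' [fr fa] kN hk hD; apply: wp_set_reg => //=.
      rewrite hk hD fa //= h1; apply: small_D.
      have := den_basis_bound kN; rewrite /den_basis big_ord_recr /= => -[_].
      by [].
    by rewrite hk hD fa //= h1 /den_basis big_ord_recr.
  move=> M1 [fr1 fa1] hD [fr1' fa1'].
  apply: (@wp_for _ _ _ _ _ _ y3 m 1 (fun k M' => mr M' rD = den_target k)) => //=.
  - exact: small_nat m_le_y.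
  - by move=> M' [fr _]; rewrite fr //= fr1' //= hm.
  - by rewrite /den_target big_ord0 mulr1.
  - move=> k M' [fr fa] kN hk hD'; apply: wp_set_reg => //=.
      rewrite hk hD' fa //= fa1' //= h3; apply: small_D.
      have := den_target_bound kN; rewrite /den_target big_ord_recr /= mulrA => -[_].
      by [].
    by rewrite hk hD' fa //= fa1' //= h3 /den_target big_ord_recr /= mulrA.
by have := nm_le; have := m_le_y; have := y3; move: (n * m)%N => z; lia.
Qed.

Lemma weightS k : weight k.+1 = weight k + 2 * (T k * T k).
Proof. by rewrite /weight big_ord_recr /= mulrDr. Qed.

Lemma small_T j : (j < m)%N -> smallI (T j).
Proof. by move=> jm; apply: small_exp (T_lt jm) (leq_trans _ (leq_addl _ _)). Qed.

Lemma small_weight i : (i <= m)%N -> smallI (weight i).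
Proof.
move=> im; have [_ h] := weight_bound im.
by apply: small_exp h (leq_trans _ (leq_addl _ _)).
Qed.

Lemma lt_m_exp k : (k <= m)%N -> (k < 2 ^ y)%N.
Proof. by move=> km; apply: small_nat; apply: leq_trans km m_le_y. Qed.

Lemma wp_rescale_target M :
  mr M rM = m%:Z -> mr M rD = D -> mr M rW = 0 ->
  (forall k, ma M 2 k = numq (tgt k)) -> (forall k, ma M 3 k = denq (tgt k)) ->
  wpI rescale_target (10 * y) (fun M' => mr M' rW = W /\
    forall j, (j < m)%N -> ma M' 7 j = T j) M.
Proof.
move=> hm hD hW h2 h3; have my := m_le_y.
apply: wp_weaken (_ : wpI _ (m * 4 + 2) _ M) _ _; [|by lia|by move=> M' h; exact: h].
apply: (@wp_for _ _ _ _ _ _ y3 m (1 + 1) (fun k M' => mr M' rW = weight k /\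
    forall j, (j < k)%N -> ma M' 7 j = T j)) => //=.
- exact: lt_m_exp.
- by move=> M' [fr _]; rewrite fr.
- by rewrite /weight big_ord0.
- move=> k M' [fr fa] km hk [hW' hT].
  have E7 : (ma M' 2 k * mr M' 2 %/ ma M' 3 k)%Z = T k.
    by rewrite fr //= !fa //= h2 h3 hD.
  apply: wp_seq; apply: wp_set_arr => //=; rewrite hk /= E7; first exact: small_T.
  apply: wp_set_reg => //=; rewrite hk /= eqxx hW' -weightS; first exact: small_weight.
  split=> // j; rewrite ltnS leq_eqVlt => /predU1P[->|jk]; first by rewrite eqxx.
  by rewrite hT // ltn_eqF.
Qed.

Lemma wp_count_codes M : mr M rM = m%:Z ->
  wpI count_codes (10 * y) (fun M' => mr M' rCodes = 2 ^+ E /\ mr M' rB = b%:Z) M.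
Proof.
move=> hm; have my := m_le_y; have Ey := E_le_y.
have Sy := S_le_y; have mS := dm_le; have ES := E_le.
apply: wp_weaken (_ : wpI _ (1 + ((m * 3 + 2) + (1 + (1 + (1 + ((E * 3 + 2) + 1))))))%N _ M) _ _;
  [|by have := y3; lia|by move=> M' h; exact: h].
apply: wp_seq; apply: wp_set_reg => //=.
apply: wp_seq; apply: wp_frame.
apply: (@wp_for _ _ _ _ _ _ y3 m 1 (fun k M' => mr M' rPow = 2 ^+ k)) => //=.
- exact: lt_m_exp.
- by move=> M' [fr _]; rewrite fr.
- move=> k M' _ km _ h; apply: wp_set_reg => //=; rewrite h exp2_double //.
  by apply: small_pow2; lia.
move=> M1 _ hP [fr1 _].
have hm1 : mr M1 1 = m%:Z by rewrite fr1.
have [F FE Fm] := floor_e.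
apply: wp_seq; apply: wp_param => //=; rewrite hm1 /=; first exact: m_le_y.
  rewrite theta2 FE /small absz_nat; apply: (ltn_trans Fm); rewrite ltn_exp2l //; lia.
have E2 : (2 <= E)%N by rewrite /E leq_addl.
have EE : ((Num.floor (2 ^+ m * theta 2) * m) %/ 2 ^+ m)%Z + 2 = E%:Z.
  by rewrite theta2 E_quo -PoszD subnK.
apply: wp_seq; apply: wp_set_reg => //=; rewrite hm1 hP EE; first exact: small_nat.
apply: wp_seq; apply: wp_set_reg => //=.
apply: wp_seq; apply: wp_frame.
apply: (@wp_for _ _ _ _ _ _ y3 E 1 (fun k M' => mr M' rCodes = 2 ^+ k)) => //=.
- by apply: small_nat.
- by move=> M' [fr _]; rewrite fr.
- move=> k M' _ km _ h; apply: wp_set_reg => //=; rewrite h exp2_double //.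
  by apply: small_pow2; lia.
move=> M2 _ hC [fr2 _].
have bE : (2 * mr M2 1 %/ mr M2 21)%Z + 1 = b%:Z.
  by rewrite !fr2 //= hm1 -PoszM divz_nat -PoszD addn1.
apply: wp_set_reg => //=; rewrite bE //.
apply: small_nat; rewrite /b; move: (leq_div (2 * m) E) mS Sy.
by move: (2 * m %/ E)%N => z; clear; lia.
Qed.

Lemma score_exp_le l : (l <= 16 * S)%N -> (score_exp p l <= 8 * a * S)%N.
Proof.
move=> l16; have p0 : 0 <= p := le_trans ler01 p1.
have /andP[_ h] := score_exp_bounds l p0.
rewrite -(ler_nat R); apply: le_trans h _.
have : p * l%:R <= a%:R * (16 * S)%:R by apply: ler_pM => //; rewrite ler_nat.
rewrite !natrM; lra.
Qed.

Lemma trunc_log_sqr (x : int) : (`|x| < 2 ^ (8 * S))%N ->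
  (trunc_log 2 `|(x * x)%R| < 16 * S)%N.
Proof.
move=> hx; case: (posnP `|(x * x)%R|%N) => [->|x0]; first by rewrite trunc_log0.
rewrite -(@ltn_exp2l 2) //; apply: leq_ltn_trans (trunc_logP _ x0) _ => //.
by rewrite (expS_split 8 8) absz_mul_lt.
Qed.

Lemma score1_le (x : int) : (`|x| < 2 ^ (8 * S))%N -> score1 p x <= 2 ^+ (8 * a * S).
Proof.
move=> hx; rewrite /score1 divzz.
have h : 2 ^+ score_exp p (trunc_log 2 `|(x * x)%R|) <= 2 ^+ (8 * a * S) :> int.
  by apply: ler_weXn2l => //; apply: score_exp_le; rewrite ltnW // trunc_log_sqr.
by case: (_ != 0); rewrite ?mul1r // mul0r exprn_ge0.
Qed.

Lemma wp_score_coordinate M j (V := (ma M 4 j * D %/ ma M 5 j)%Z) :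
  ready M -> mr M rJ = j%:Z -> (j < m)%N -> (`|ma M 4 j| <= `|W|)%N ->
  0 <= mr M rScore -> smallI (mr M rScore + 2 ^+ (8 * a * S)) ->
  wpI score_coordinate (10 * y) (fun M' => mr M' rScore = mr M rScore + score1 p (V - T j) /\
    forall i, ma M' 8 i = if i == j then V else ma M 8 i) M.
Proof.
move=> rM hj jm hn s0 sB.
have Sy := S_le_y; have p0 : 0 <= p := le_trans ler01 p1.
have hD := ready_D rM; have hT := ready_T rM.
have V7 : (`|V| < 2 ^ (7 * S))%N.
  apply: leq_ltn_trans (absz_divz_le _ _) _.
  rewrite (expS_split 6 1) mul1n; apply: absz_mul_lt D_lt.
  exact: leq_ltn_trans hn W_lt.
set x := V - T j.
have x8 : (`|x| < 2 ^ (8 * S))%N.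
  apply: (absz_add_lt V7) (expS_double S0 (isT : (7 < 8)%N)).
  by rewrite abszN; apply: leq_trans (T_lt jm) (expS_le _ _).
have x16 : (`|(x * x)%R| < 2 ^ (16 * S))%N.
  by rewrite (expS_split 8 8); exact: absz_mul_lt.
pose l := trunc_log 2 `|(x * x)%R|%N.
have l16 : (l < 16 * S)%N := trunc_log_sqr x8.
pose u := score_exp p l.
have u8 : (u <= 8 * a * S)%N by apply: score_exp_le; exact: ltnW.
have h_lu : (l + u + 20 <= y)%N.
  by move: l16 u8 S0; rewrite /y; move: (l) (u) (S); clear; lia.
have h_al : ((a + l).+1 <= y)%N.
  by move: l16 S0 a0; rewrite /y; move: (l) (S) (a); clear; nia.
apply: wp_weaken (_ : wpI _ (1 + (1 + (1 + (1 + (1 + ((l * 3 + 1) +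
   (1 + (1 + (1 + ((u * 3 + 2) + 1))))))))))%N _ M) _ _; 
  [|by move: h_lu; move: (l) (u) (y); clear; lia|by move=> M' h; exact: h].
have sn : smallI (ma M 4 j).
  by apply: leq_ltn_trans hn _; exact: small_weight.
apply: wp_seq; apply: wp_set_arr => //=; rewrite ?hj //= ?hD -/V.
  by apply: small_exp V7 (leq_trans _ (leq_addl _ _)).
apply: wp_seq; apply: wp_set_reg => //=; rewrite hj /= eqxx hT // -/x.
  by apply: small_exp x8 (leq_trans _ (leq_addl _ _)).
apply: wp_seq; apply: wp_set_reg => //=.
  by apply: small_exp x16 (leq_trans _ (leq_addl _ _)).
apply: wp_seq; apply: wp_set_reg => //=.
apply: wp_seq; apply: wp_set_reg => //=.
set M0 := setr _ _ _.
apply: wp_seq; apply: wp_frame.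
have xx0 : 0 <= x * x by rewrite -expr2 sqr_ge0.
apply: (@wp_while _ _ _ _ _ _ y3 l (1 + 1) (fun k M' =>
   [/\ mr M' rPow = 2 ^+ k, mr M' rLog = k%:Z & (k <= l)%N])) => //=.
  move=> k M' [fr _] [hP hL kl]; rewrite hP fr //= => lt.
  have k1l : (k < l)%N.
    apply: trunc_log_max => //; rewrite -lez_nat gez0_abs // expnS mul2n -addnn PoszD.
    by move: lt; rewrite -natz natrX; clear; lia.
  split=> //; apply: wp_seq; apply: wp_set_reg => //=; rewrite hP exp2_double.
    by apply: small_pow2; move: k1l h_lu; clear; lia.
  apply: wp_set_reg => //=; rewrite hL -PoszD addn1.
    by apply: small_nat; move: k1l h_lu; clear; lia.
  by [].
move=> k M1 _ [hP hL kl] ge [fr1 fa1].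
have {kl ge} kl : k = l.
  apply/eqP; rewrite eqn_leq kl /=.
  case: (posnP `|(x * x)%R|%N) => [z|z]; first by rewrite /l z trunc_log0.
  rewrite -ltnS -(@ltn_exp2l 2) //; apply: leq_ltn_trans (trunc_logP _ z) _ => //.
  rewrite -ltz_nat gez0_abs // expnS mul2n -addnn PoszD.
  by move: ge; rewrite fr1 //= hP -natz natrX; clear; lia.
subst k.
have F0 : 0 <= Num.floor (2 ^+ l * p) by rewrite floor_ge0 mulr_ge0 // exprn_ge0.
apply: wp_seq; apply: wp_param => //=; rewrite hL /=; first by move: h_lu; clear; lia.
  have Fl : (`|Num.floor (2 ^+ l * p)| < 2 ^ (a + l).+1)%N.
    rewrite -ltz_nat gez0_abs // -(ltr_int R) -[(Posz _)%:~R]/((2 ^ _)%:R) natrX.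
    apply: le_lt_trans (floor_le _) _.
    apply: le_lt_trans (_ : _ <= 2 ^+ l * a%:R) _; first by rewrite ler_pM2l ?exprn_gt0.
    apply: lt_trans (_ : 2 ^+ l * 2 ^+ a < _).
      by rewrite ltr_pM2l ?exprn_gt0 // natr_lt_exp2.
    by rewrite -exprD -natrX -natrX ltr_nat ltn_exp2l // addnC.
  by rewrite theta0; apply: leq_trans Fl _; rewrite leq_exp2l.
have uE : (Num.floor (2 ^+ l * theta 0) * l%:Z %/ (2 * 2 ^+ l))%Z = u%:Z.
  by rewrite theta0 score_exp_ge0.
apply: wp_seq; apply: wp_set_reg => //=; rewrite hL hP uE.
  by apply: small_nat; move: h_lu; clear; lia.
have hx1 : mr M1 rX = x * x by rewrite fr1.
apply: wp_seq; apply: wp_set_reg => //=; rewrite hx1.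
  by rewrite divzz; case: (_ != 0).
apply: wp_seq; apply: wp_frame.
apply: (@wp_for _ _ _ _ _ _ y3 u 1 (fun k M' =>
  mr M' rTerm = (x * x %/ (x * x))%Z * 2 ^+ k)) => //=.
- by apply: (@small_nat u); move: h_lu; clear; lia.
- by move=> M' [fr _]; rewrite fr.
- by rewrite mulr1.
- move=> k M' _ ku _ hk; apply: wp_set_reg => //=; rewrite hk -mulrDr exp2_double //.
  rewrite divzz; case: (_ != 0); rewrite ?mul0r // mul1r.
  by apply: small_pow2; move: ku h_lu; clear; lia.
move=> M2 _ hT2 [fr2 fa2].
have score_eq : mr M2 rScore + mr M2 rTerm = mr M rScore + score1 p x.
  by rewrite hT2 fr2 //= fr1.
apply: wp_set_reg => //=; rewrite score_eq.
  have h1 := score1_le x8; have h0 := score1_ge0 p x.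
  move: sB h1 h0 s0; rewrite /small; move: (2 ^ y)%N (score1 p x) (2 ^+ _) (mr M rScore).
  by clear; lia.
by split=> // i; rewrite fa2 //= fa1.
Qed.

Let B0 : int := 2 ^+ (8 * a * S).

Lemma B0_ge1 : 1 <= B0. Proof. by rewrite exprn_ege1. Qed.

Lemma small_score (r best : int) : 0 <= best <= m%:Z * B0 -> 0 <= r ->
  r <= m.+1%:Z * (B0 + best + 1) -> smallI r.
Proof.
move=> /andP[b0 b1] r0 r1; have B1 := B0_ge1.
have mx : (m.+1 <= 2 ^ S)%N by apply: leq_trans (ltnW S_lt); exact: dm_le.
rewrite /small -ltz_nat gez0_abs //; apply: le_lt_trans r1 _.
have BE : B0 = (2 ^ (8 * a * S))%N%:Z by rewrite /B0 -natz natrX.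
apply: (@le_lt_trans _ _ ((2 ^ S * (2 * 2 ^ S) * 2 ^ (8 * a * S))%N%:Z)).
  by rewrite PoszM -BE; exact: score_room.
rewrite ltz_nat -expnS -!expnD ltn_exp2l // /y.
by move: S0; move: (S) (a); clear => s a s0; nia.
Qed.

Lemma wp_score_answer M (V := fun j => (ma M 4 j * D %/ ma M 5 j)%Z) :
  ready M -> 0 <= mr M rBest <= m%:Z * B0 ->
  wpI score_answer (20 * y ^ 2) (fun M' =>
    [/\ 0 <= mr M' rScore,
        (forall j, (j < m)%N -> (`|ma M 4 j| <= `|W|)%N) ->
        [/\ mr M' rScore = score p m (fun j => V j - T j),
            mr M' rScore <= m%:Z * B0
          & forall j, (j < m)%N -> ma M' 8 j = V j]
      & (exists2 j, (j < m)%N & (`|W| < `|ma M 4 j|)%N) -> mr M rBest < mr M' rScore]) M.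
Proof.
move=> rM hb; have /andP[b0 b1] := hb; have my := m_le_y; have B1 := B0_ge1.
have W0 := W_ge0.
have hm := ready_m rM.
apply: wp_weaken (_ : wpI _ (1 + (m * ((10 * y).+2).+2 + 2))%N _ M) _ _; last 1 first.
- by move=> M' h; exact: h.
- apply: wp_seq; apply: wp_set_reg => //=; set M0 := setr _ _ _.
  have rM0 : ready M0 by case: rM => *; split.
  apply: (@wp_for _ _ _ _ _ _ y3 m (10 * y).+2 (fun k M' =>
    [/\ 0 <= mr M' rScore <= k%:Z * (B0 + mr M rBest + 1),
        (forall j, (j < k)%N -> (`|ma M 4 j| <= `|W|)%N) ->
        [/\ mr M' rScore = \sum_(j < k) score1 p (V j - T j),
            mr M' rScore <= k%:Z * B0
          & forall j, (j < k)%N -> ma M' 8 j = V j]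
      & (exists2 j, (j < k)%N & (`|W| < `|ma M 4 j|)%N) -> mr M rBest < mr M' rScore])) => //=.
  + exact: lt_m_exp.
  + by move=> M' [fr _]; rewrite fr.
  + by split; [rewrite mul0r lexx|move=> _; rewrite big_ord0 mul0r|case].
  + move=> k M' fM km hk [/andP[s0 s1] hok hbad].
    have [fr fa] := fM.
    have rM' : ready M' by exact: ready_frame fM isT isT rM0.
    have hW' : mr M' rW = W := ready_W rM'.
    have fb : mr M' rBest = mr M rBest by rewrite fr.
    have kk : mr M' rScore <= m%:Z * (B0 + mr M rBest + 1).
      apply: le_trans s1 _; rewrite ler_wpM2r //; last by rewrite lez_nat ltnW.
      by move: B1 b0; clear; lia.
    have rej : (`|W| < `|ma M 4 k|)%N -> wpI reject 1 (fun M' =>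
      [/\ 0 <= mr M' rScore <= k.+1%:Z * (B0 + mr M rBest + 1),
        (forall j, (j < k.+1)%N -> (`|ma M 4 j| <= `|W|)%N) ->
        [/\ mr M' rScore = \sum_(j < k.+1) score1 p (V j - T j),
            mr M' rScore <= k.+1%:Z * B0
          & forall j, (j < k.+1)%N -> ma M' 8 j = V j]
      & (exists2 j, (j < k.+1)%N & (`|W| < `|ma M 4 j|)%N) -> mr M rBest < mr M' rScore]) M'.
      move=> lt; apply: wp_set_reg => //=; rewrite fb.
        apply: (small_score hb); first by move: s0 b0; clear; lia.
        by move: kk B1 b0; rewrite intS mulrDl mul1r; move: (_ * _) => z; clear; lia.
      split.
      - move: s0 s1 b0 B1; rewrite intS mulrDl mul1r; move: (_ * _) => z; clear; lia.
      - by move=> /(_ k (ltnSn k)); rewrite leqNgt lt.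
      - by move=> _; move: s0; clear; lia.
    have rd5 : (`|ma M 4 k| <= `|W|)%N -> wpI score_coordinate (10 * y) (fun M' =>
      [/\ 0 <= mr M' rScore <= k.+1%:Z * (B0 + mr M rBest + 1),
        (forall j, (j < k.+1)%N -> (`|ma M 4 j| <= `|W|)%N) ->
        [/\ mr M' rScore = \sum_(j < k.+1) score1 p (V j - T j),
            mr M' rScore <= k.+1%:Z * B0
          & forall j, (j < k.+1)%N -> ma M' 8 j = V j]
      & (exists2 j, (j < k.+1)%N & (`|W| < `|ma M 4 j|)%N) -> mr M rBest < mr M' rScore]) M'.
      move=> le; have VE : (ma M' 4 k * D %/ ma M' 5 k)%Z = V k by rewrite !fa.
      have x8 : (`|(V k - T k)%R| < 2 ^ (8 * S))%N.
        apply: (@absz_add_lt _ _ (2 ^ (7 * S))); last exact: (expS_double S0 (isT : (7 < 8)%N)).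
          apply: leq_ltn_trans (absz_divz_le _ _) _.
          rewrite (expS_split 6 1) mul1n; apply: absz_mul_lt D_lt.
          exact: leq_ltn_trans le W_lt.
        by rewrite abszN; apply: leq_trans (T_lt km) (expS_le _ _).
      have h1 := score1_le x8; have h0 := score1_ge0 p (V k - T k).
      apply: wp_weaken (wp_score_coordinate rM' hk km _ s0 _) _ _ => //.
      - by rewrite fa.
      - apply: (small_score hb); first by move: s0 B1; rewrite /B0; clear; lia.
        by move: kk B1 b0; rewrite /B0 intS mulrDl mul1r; move: (_ * _) => z; clear; lia.
      move=> M1; rewrite VE => -[-> h8]; split.
      - move: s0 s1 b0 B1 h0 h1; rewrite -/B0 intS mulrDl mul1r; move: (_ * _) => z; clear; lia.
      - move=> hj; have [hj' hs hV] := hok (fun j jk => hj j (ltnW jk)); split.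
        + by rewrite big_ord_recr /= hj'.
        + by rewrite intS mulrDl mul1r addrC; exact: lerD h1 hs.
        + move=> j; rewrite ltnS leq_eqVlt h8 => /predU1P[->|jk]; first by rewrite eqxx.
          by rewrite ltn_eqF // hV.
      - case=> j; rewrite ltnS leq_eqVlt => /predU1P[->|jk] hj.
          by move: hj; rewrite ltnNge le.
        apply: lt_le_trans (hbad _) _; first by exists j.
        by rewrite lerDl.
    have fk : ma M' 4 k = ma M 4 k by rewrite fa.
    apply: wp_if => //=; first by split=> //; right.
      rewrite hk hW' /= fk => lt1; apply: wp_if => //=; first by split=> //; left.
        rewrite hk hW' /= fk => lt2; apply: rd5.
        by move: lt1 lt2 W0; clear; lia.
      rewrite hk hW' /= fk => lt2; apply: wp_weaken (rej _) _ _ => //; last by have := y3; lia.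
      by move: lt1 lt2 W0; clear; lia.
    rewrite hk hW' /= fk => lt1; apply: wp_weaken (rej _) _ _ => //.
    by move: lt1 W0; clear; lia.
  + by move=> M' _ [/andP[s0 _] h1 h2].
- by move: my y3; clear; nia.
Qed.

Lemma b_le : (b <= 2 * S)%N.
Proof.
rewrite /b; move: (leq_div (2 * m) E) dm_le; move: (2 * m %/ E)%N (m) (S) => z k s; clear; lia.
Qed.

Lemma small_pos k : (k <= (E + 1) * b)%N -> smallI k%:Z.
Proof.
move=> kE; apply: (@small_exp _ 8); last by apply: leq_trans (leq_addl _ _).
rewrite absz_nat; apply: leq_ltn_trans kE _.
have h1 : (E + 1 <= 2 ^ (3 * S))%N.
  by rewrite addn1; apply: leq_ltn_trans E_le_S _; rewrite ltn_expl.
have h2 : (b <= 2 * 2 ^ S)%N.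
  by move: b_le S_lt; move: (2 ^ S)%N (b); clear; lia.
apply: leq_ltn_trans (leq_mul h1 h2) _.
rewrite mulnCA -[(2 ^ (3 * S) * _)%N]expnD -expnS ltn_exp2l //.
by move: S0; clear; lia.
Qed.

Lemma sign_parity (h : nat) : 1 + (4 * (h./2)%:Z - 2 * h%:Z) = (-1) ^+ odd h :> int.
Proof.
have := odd_double_half h; rewrite -mul2n; move: (odd h) (h./2) => o d <-.
by rewrite PoszD PoszM; case: o; rewrite ?expr1 ?expr0; lia.
Qed.

Definition target_entry_bound (g : int) (k j : nat) (v : int) : Prop :=
  `|v| <= `|T j| + k%:Z * g.

Lemma small_target_entry g k j v : (j < m)%N -> 0 <= g -> (`|g| < 2 ^ (10 * S))%N ->
  (k <= E + 1)%N -> target_entry_bound g k j v -> smallI v.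
Proof.
move=> jm g0 gS kE hv; apply: (@small_exp _ 14); last by apply: leq_trans (leq_addl _ _).
have hT := T_lt jm.
have k3 : (k <= 2 ^ (3 * S))%N.
  have := E_le_S; have : (3 * S < 2 ^ (3 * S))%N by exact: ltn_expl.
  by move: kE; move: (2 ^ _)%N; clear; lia.
have h1 : (2 ^ (2 * S) <= 2 ^ (13 * S))%N by exact: expS_le.
have h2 := expS_double S0 (isT : (13 < 14)%N).
have h3 : (k * `|g| <= 2 ^ (13 * S))%N.
  by rewrite (expS_split 3 10) leq_mul // ltnW.
move: hv h1 h2 h3 hT; rewrite /target_entry_bound -[X in k%:Z * X](gez0_abs g0) -PoszM.
move: (2 ^ (2 * S))%N (2 ^ (13 * S))%N (2 ^ (14 * S))%N (k * _)%N (T j); clear; lia.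
Qed.

Lemma wp_add_unit_entry M (h pos k : nat) g : ready M -> mr M rH = h%:Z ->
  mr M rPos = pos%:Z -> (h < 2 ^ E)%N -> (pos <= k * b)%N -> (k < E)%N ->
  mr M rG = g -> 0 <= g -> (`|g| < 2 ^ (10 * S))%N ->
  (forall j, (j < m)%N -> target_entry_bound g k j (ma M 2 j)) ->
  wpI add_unit_entry 5 (fun M' =>
    mr M' rC = ((h %/ b)./2)%:Z /\ forall j, (j < m)%N -> ma M' 2 j = ma M 2 j +
      g * (if (pos + h %% b)%N == j then (-1) ^+ odd (h %/ b) else 0)) M.
Proof.
move=> rM hh hpos hE pb kE hg g0 gS hj; have hb := ready_b rM; have hm := ready_m rM.
pose Q := (h %/ b)%N.
have Qh : (Q <= h)%N by exact: leq_div.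
have small_h (x : nat) : (x <= h)%N -> smallI x%:Z.
  move=> xh; rewrite /small absz_nat; apply: leq_ltn_trans xh (leq_trans hE _).
  by rewrite leq_exp2l // E_le_y.
have idx : pos%:Z + (h%:Z - b%:Z * Q%:Z) = (pos + h %% b)%N%:Z.
  by rewrite {1}(divn_eq h b) -/Q !PoszD PoszM; ring.
have half : (Q%:Z %/ 2)%Z = (Q./2)%:Z by rewrite divz_nat divn2.
apply: (@wp_seq _ _ _ _ _ _ _ _ 1 4); apply: wp_set_reg => //=; rewrite hh hb divz_nat -/Q.
  exact: small_h.
apply: (@wp_seq _ _ _ _ _ _ _ _ 1 3); apply: wp_set_reg => //=; rewrite hh hb hpos idx.
  apply: small_pos; apply: ltnW; have : (h %% b < b)%N by rewrite ltn_pmod.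
  by move: pb kE; move: (h %% b)%N (b) (E); clear; nia.
have sQ : smallI (Q./2)%:Z by apply: small_h; apply: leq_trans Qh; exact: half_le.
apply: (@wp_seq _ _ _ _ _ _ _ _ 2 1); apply: wp_if => //=; first by split=> //=; left.
  rewrite hm ltz_nat => lt; apply: wp_set_arr => //=; rewrite half sign_parity hg.
    apply: (@small_target_entry g k.+1 _ _ lt g0 gS); first by rewrite addn1 ltnW.
    have := hj _ lt; rewrite /target_entry_bound intS mulrDl mul1r.
    by case: (odd _); rewrite ?expr1 ?expr0; move: g0; clear; lia.
  apply: wp_set_reg => //=; rewrite half //; split=> // j jm.
  by rewrite eq_sym; case: eqP => [->|_]; rewrite ?mulr0 ?addr0.
rewrite hm lez_nat => ge.
apply: wp_weaken (_ : wpI _ 0 _ _) (leq0n 1) _; last by move=> M'; exact: id.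
apply: wp_skip; apply: wp_set_reg => //=; rewrite half //; split=> // j jm.
by rewrite gtn_eqF ?mulr0 ?addr0 //; apply: leq_trans jm ge.
Qed.

Lemma wp_add_code M (c : nat) g : ready M -> mr M rC = c%:Z -> (c < 2 ^ E)%N ->
  mr M rPos = 0 -> mr M rG = g -> 0 <= g -> (`|g| < 2 ^ (10 * S))%N ->
  (forall j, (j < m)%N -> ma M 2 j = T j) ->
  wpI add_code (10 * y) (fun M' =>
    forall j, (j < m)%N -> ma M' 2 j = T j + g * zdecode b c 0 j) M.
Proof.
move=> rM hc cE hpos hg g0 gS hT; have Ey := E_le_y.
apply: wp_weaken (_ : wpI _ (E * (1 + 6).+1 + 1) _ M) _ _; last 1 first.
- by move=> M' h; exact: h.
- apply: (@wp_while _ _ _ _ _ _ y3 E (1 + 6) (fun k M' => exists c' pos : nat,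
    [/\ mr M' rC = c'%:Z, (c' * 2 ^ k <= c)%N, mr M' rPos = pos%:Z, (pos <= k * b)%N &
      forall j, (j < m)%N -> ma M' 2 j + g * zdecode b c' pos j = T j + g * zdecode b c 0 j
        /\ target_entry_bound g k j (ma M' 2 j)])) => //=.
  + exists c, 0%N; split=> //; first by rewrite muln1.
    by move=> j jm; rewrite hT // /target_entry_bound mul0r addr0.
  + move=> k M' fM [c' [pos [hc' c'c hpos' pb hj]]]; rewrite hc' ltz_nat => c'0.
    have [fr fa] := fM.
    have rM' : ready M' by exact: ready_frame fM isT isT rM.
    have kE : (k < E)%N.
      rewrite -(@ltn_exp2l 2) //; apply: leq_ltn_trans cE; apply: leq_trans c'c.
      by rewrite leq_pmull.
    split=> //; have half : (c'%:Z %/ 2)%Z = (c'./2)%:Z by rewrite divz_nat divn2.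
    have c'E : (c' < 2 ^ E)%N.
      by apply: leq_ltn_trans cE; apply: leq_trans c'c; rewrite leq_pmulr // expn_gt0.
    have small_c x : (x <= c')%N -> smallI x%:Z.
      move=> xc; rewrite /small absz_nat; apply: leq_ltn_trans xc (leq_trans c'E _).
      by rewrite leq_exp2l.
    have hc2 : (c'./2 <= c')%N by exact: half_le.
    apply: wp_seq; apply: wp_set_reg => //=; rewrite hc' half; first exact: small_c.
    have rM1 : ready (setr M' rH (c'./2)%:Z) by case: rM' => *; split.
    have step : ((c'./2) * 2 ^ k.+1 <= c)%N.
      apply: leq_trans c'c; rewrite expnS mulnA leq_mul2r -[(_ * 2)%N]mulnC mul2n.
      by rewrite -[X in (_ <= X)%N]odd_double_half leq_addl orbT.
    apply: wp_if => //=; first by split=> //=; left.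
      rewrite hc' -PoszD ltz_nat addnn => lt.
      have oc : odd c'.
        move: lt; rewrite -[X in (_ < X)%N]odd_double_half.
        by case: (odd c') => //; rewrite ltnn.
      apply: wp_frame.
      apply: wp_weaken (@wp_add_unit_entry _ c'./2 pos k g rM1 _ _ _ pb kE _ g0 gS _)
        (leqnn _) _ => //=.
      * exact: leq_ltn_trans hc2 c'E.
      * by rewrite fr.
      * by move=> j jm; have [] := hj j jm.
      move=> M1 [hC1 h2] [fr1 _].
      exists (c'./2 %/ b)./2, pos; split=> //.
      * apply: leq_trans step; rewrite leq_mul2r; apply/orP; right.
        by apply: leq_trans (half_le _) (leq_div _ _).
      * by rewrite fr1.
      * by apply: leq_trans pb _; rewrite leq_mul2r leqnSn orbT.
      move=> j jm; have [e1 e2] := hj j jm; rewrite h2 //; split.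
        by rewrite -e1 (zdecode_odd _ _ _ oc); ring.
      move: e2; rewrite /target_entry_bound intS mulrDl mul1r.
      case: ifP => _; rewrite ?mulr0 ?addr0; last by move: g0; clear; lia.
      by case: (odd _); rewrite ?expr1 ?expr0; move: g0; clear; lia.
    rewrite hc' -PoszD lez_nat addnn => le.
    have oc : ~~ odd c'.
      by apply/negP => o; move: le; rewrite -[X in (X <= _)%N]odd_double_half o ltnn.
    have pb' : (pos + b <= k.+1 * b)%N by rewrite mulSn addnC leq_add2l.
    apply: wp_weaken (_ : wpI _ (1 + 1) _ _) _ _; [|by []|by move=> M1 h; exact: h].
    apply: wp_seq; apply: wp_set_reg => //=; first exact: small_c.
    have hb : mr M' rB = b%:Z := ready_b rM'.
    apply: wp_set_reg => //=; rewrite hpos' hb -PoszD.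
      apply: small_pos; apply: leq_trans pb' _; rewrite leq_mul2r; apply/orP; right.
      by rewrite addn1 ltnS ltnW.
    exists c'./2, (pos + b)%N; split=> // j jm; have [e1 e2] := hj j jm; split.
      by rewrite -e1 (zdecode_even _ _ _ oc).
    by move: e2; rewrite /target_entry_bound intS mulrDl mul1r; move: g0; clear; lia.
  + move=> k M' _ [c' [pos [hc' _ _ _ hj]]]; rewrite hc' lez_nat leqn0 => /eqP c0 j jm.
    by have [<- _] := hj j jm; rewrite c0 zdecode0 mulr0 addr0.
- by move: Ey y3; clear; lia.
Qed.

Lemma eq_score (x z : nat -> int) : (forall j, (j < m)%N -> x j = z j) ->
  score p m x = score p m z.
Proof. by move=> h; apply: eq_bigr => j _; rewrite h. Qed.

Lemma D_basis i j : exists c : int, D%:~R * Defs.basis I i j = c%:~R.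
Proof.
have ij : (i * m + j < n * m)%N.
  exact: mixed_radix_ltn.
have [c hc] := prod_den_integral bas ij.
have bE : bas (i * m + j)%N = Defs.basis I i j.
  have m0 : (0 < m)%N by apply: leq_ltn_trans (ltn_ord j).
  by rewrite /bas divnMDl // modnMDl divn_small ?modn_small ?ltn_ord // addn0 entry_ord.
exists (c * \prod_(k < m) denq (tgt k)).
by rewrite /D /den_target -bE !intrM -hc; ring.
Qed.

Lemma D_target (j : 'I_m) : D%:~R * Defs.target I ord0 j = (T j)%:~R.
Proof.
have [c hc] := prod_den_integral tgt (ltn_ord j).
rewrite -entry_row -/(tgt j).
have h : D%:~R * tgt j = (den_basis (n * m) * c)%:~R by rewrite /D /den_target !intrM -hc; ring.
by rewrite h /T (rescaleE h).
Qed.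

Definition nearby (g : int) (c : nat) : instance :=
  @Instance n m (Defs.basis I) (query_target m D T (zdecode b c 0) g).

Definition answer_row g c : 'rV[rat]_m := O (nearby g c).

Hypothesis answer_lattice : forall g c, in_lattice (Defs.basis I) (answer_row g c).

Lemma answer_integral g c (j : 'I_m) :
  D%:~R * answer_row g c ord0 j = (rescale D (entry (answer_row g c) 0 j))%:~R.
Proof.
have [z hz] := in_lattice_integral D_basis (answer_lattice g c) j.
by rewrite entry_row (rescaleE hz).
Qed.

Lemma denq_answer_small g c j : (j < m)%N -> smallI (denq (entry (answer_row g c) 0 j)).
Proof.
move=> jm; have := answer_integral g c (Ordinal jm); rewrite -entry_row /= => /denq_dvd h.
apply: leq_ltn_trans (_ : `|D| < _)%N; last first.
  by apply: (@small_exp _ 1); [rewrite mul1n; exact: D_lt|exact: leq_trans (leq_addl _ _)].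
by apply: dvdn_leq => //; rewrite absz_gt0 gt_eqF // D_gt0.
Qed.

Lemma mem_instanceE M g c : ready M ->
  (forall j, (j < m)%N -> ma M 2 j = T j + g * zdecode b c 0 j /\ ma M 3 j = D) ->
  mem_instance (st w M 0) = nearby g c.
Proof.
move=> rM h; rewrite /mem_instance /= (ready_n rM) (ready_m rM) /= /nearby.
congr (@Instance _ _ _ _).
  apply/matrixP => i j; rewrite !mxE /Defs.frac (ready_num rM) (ready_den rM) divq_num_den.
  have m0 : (0 < m)%N by apply: leq_ltn_trans (ltn_ord j).
  by rewrite /bas divnMDl // modnMDl divn_small ?modn_small ?ltn_ord // addn0 entry_ord.
by apply/matrixP => i j; rewrite !mxE /Defs.frac; have [-> ->] := h j (ltn_ord j).
Qed.

Record incumbent (M : memory) : Prop := Incumbent {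
  incumbent_lattice : in_lattice (Defs.basis I) (\row_j ((ma M 6 j)%:~R / D%:~R));
  incumbent_score : mr M rBest = score p m (fun j => ma M 6 j - T j);
  incumbent_bound : 0 <= mr M rBest <= m%:Z * B0 }.

Definition covered (g : int) (c : nat) (r : int) : Prop :=
  (exists2 j, (j < m)%N & W < `|numq (entry (answer_row g c) 0 j)|) \/
  r <= score p m (fun j => rescale D (entry (answer_row g c) 0 j) - T j).

Lemma covered_le g c r r' : r' <= r -> covered g c r -> covered g c r'.
Proof. by move=> rr [h|h]; [left|right; exact: le_trans h]. Qed.

Lemma small_D : smallI D.
Proof.
by apply: (@small_exp _ 1); [rewrite mul1n; exact: D_lt|exact: leq_trans (leq_addl _ _)].
Qed.

Lemma wp_try_code M c g : ready M -> incumbent M -> mr M rCode = c%:Z -> (c < 2 ^ E)%N ->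
  mr M rG = g -> 0 <= g -> (`|g| < 2 ^ (10 * S))%N ->
  wpI try_code (40 * y ^ 2) (fun M' =>
    [/\ incumbent M', mr M' rBest <= mr M rBest & covered g c (mr M' rBest)]) M.
Proof.
move=> rM iM hc cE hg g0 gS; have my := m_le_y; have hm := ready_m rM.
have W0 := W_ge0; have D0 := D_gt0.
apply: wp_weaken (_ : wpI _ ((m * (1 + 1).+2 + 2) + (1 + (1 + (10 * y + (1 + (20 * y ^ 2 +
  (1 + (m * 3 + 2)).+1))))))%N _ M) _ _; last 1 first.
- by move=> M' h; exact: h.
- apply: wp_seq; apply: wp_frame.
  apply: (@wp_for _ _ _ _ _ _ y3 m (1 + 1) (fun k M' =>
    forall j, (j < k)%N -> ma M' 2 j = T j /\ ma M' 3 j = D)) => //=.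
  + exact: lt_m_exp.
  + by move=> M' [fr _]; rewrite fr.
  + move=> k M' fM km hk hj; have rM' : ready M' by exact: ready_frame fM isT isT rM.
    apply: wp_seq; apply: wp_set_arr => //=; rewrite hk /= (ready_T rM') //; first exact: small_T.
    apply: wp_set_arr => //=; rewrite (ready_D rM') ?hk /=; first exact: small_D.
    move=> j; rewrite ltnS leq_eqVlt => /predU1P[->|jk]; first by rewrite !eqxx.
    by rewrite ltn_eqF //; exact: hj.
  move=> M1 fM1 h1 _; have rM1 : ready M1 by exact: ready_frame fM1 isT isT rM.
  have [fr1 fa1] := fM1.
  have hc1 : mr M1 rCode = c%:Z by rewrite fr1.
  apply: wp_seq; apply: wp_set_reg => //=; rewrite hc1.
    by rewrite /small absz_nat; apply: leq_trans cE _; rewrite leq_exp2l // E_le_y.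
  apply: wp_seq; apply: wp_set_reg => //=; set M2 := setr _ _ _.
  have rM2 : ready M2 by case: rM1 => *; split.
  apply: wp_seq; apply: wp_frame.
  apply: wp_weaken (@wp_add_code M2 c g rM2 _ cE _ _ g0 gS _) (leqnn _) _ => //=.
  + by rewrite fr1.
  + by move=> j jm; have [] := h1 j jm.
  move=> M3 h3 fM3; have rM3 : ready M3 by exact: ready_frame fM3 isT isT rM2.
  have [fr3 fa3] := fM3.
  have JE : mem_instance (st w M3 0) = nearby g c.
    apply: mem_instanceE => // j jm; rewrite h3 //; split=> //.
    by rewrite fa3 //=; have [] := h1 j jm.
  apply: wp_seq; apply: wp_frame; apply: wp_query => //; rewrite ?JE //.
  + by apply: leq_trans rk_le my.
  + exact: denq_answer_small.
  rewrite -/(answer_row g c) => M4 m4 _ h4 fM4.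
  have rM4 : ready M4 by exact: ready_frame fM4 isT isT rM3.
  have best4 : mr M4 rBest = mr M rBest by rewrite m4 fr3 //= fr1.
  have a64 : ma M4 6 = ma M 6 by have [_ fa4] := fM4; rewrite fa4 // fa3 //= fa1.
  have hb4 : 0 <= mr M4 rBest <= m%:Z * B0 by rewrite best4; exact: incumbent_bound iM.
  apply: wp_seq; apply: wp_frame; apply: wp_weaken (wp_score_answer rM4 hb4) (leqnn _) _ => //.
  move=> M5 [s5 hok hbad] fM5; have rM5 : ready M5 by exact: ready_frame fM5 isT isT rM4.
  have [fr5 fa5] := fM5.
  have best5 : mr M5 rBest = mr M rBest by rewrite fr5.
  have a65 : ma M5 6 = ma M 6 by rewrite fa5.
  have VE j : (j < m)%N -> (ma M4 4 j * D %/ ma M4 5 j)%Z = rescale D (entry (answer_row g c) 0 j).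
    by move=> jm; have [-> ->] := h4 j jm.
  have sE : score p m (fun j => (ma M4 4 j * D %/ ma M4 5 j)%Z - T j) =
            score p m (fun j => rescale D (entry (answer_row g c) 0 j) - T j).
    by apply: eq_score => j jm; rewrite VE.
  have range : (forall j, (j < m)%N -> (`|ma M4 4 j| <= `|W|)%N) \/
      (exists2 j, (j < m)%N & (`|W| < `|ma M4 4 j|)%N).
    have [/forallP h|] := boolP [forall j : 'I_m, (`|ma M4 4 j| <= `|W|)%N].
      by left=> j jm; exact: (h (Ordinal jm)).
    by rewrite negb_forall => /existsP[j]; rewrite -ltnNge => h; right; exists j.
  apply: wp_if => //=; first by split=> //=; left.
    rewrite best5 => lt.
    have ok : forall j, (j < m)%N -> (`|ma M4 4 j| <= `|W|)%N.
      case: range => // /hbad; rewrite best4 => lt'.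
      by have := lt_trans lt lt'; rewrite ltxx.
    have [hs hsB hV] := hok ok.
    have small_s : smallI (mr M5 rScore).
      apply: (small_score hb4 s5); apply: le_trans hsB _.
      apply: ler_pM => //; [exact: le_trans B0_ge1|rewrite lez_nat //|].
      by rewrite -addrA lerDl addr_ge0 //; have /andP[] := hb4.
    apply: wp_seq; apply: wp_set_reg => //=; set M6 := setr _ _ _.
    apply: wp_frame; apply: (@wp_for _ _ _ _ _ _ y3 m 1 (fun k M' =>
      forall j, (j < k)%N -> ma M' 6 j = rescale D (entry (answer_row g c) 0 j))) => //=.
    + exact: lt_m_exp.
    + by move=> M' [fr _]; rewrite fr //= (ready_m rM5).
    + move=> k M' [fr fa] km hk hj.
      have e8 : ma M' 8 k = rescale D (entry (answer_row g c) 0 k) by rewrite fa //= hV ?VE.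
      apply: wp_safe => -[_ sa _].
      apply: wp_set_arr => //=; rewrite hk //=; first exact: sa.
      move=> j; rewrite ltnS leq_eqVlt => /predU1P[->|jk]; first by rewrite eqxx e8.
      by rewrite ltn_eqF //; exact: hj.
    move=> M7 _ h7 [fr7 _].
    have best7 : mr M7 rBest = mr M5 rScore by rewrite fr7.
    have s7 : mr M5 rScore = score p m (fun j => ma M7 6 j - T j).
      by rewrite hs sE; apply: eq_score => j jm; rewrite h7.
    split; rewrite ?best7 //; last 2 first.
    + exact: ltW.
    + by right; rewrite hs sE.
    split; rewrite ?best7 //; last by rewrite s5.
    rewrite (_ : \row_j _ = answer_row g c); first exact: answer_lattice.
    apply/rowP => j; rewrite mxE h7 // -answer_integral mulrC mulKf //.
    by rewrite intr_eq0 gt_eqF.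
  rewrite best5 => ge; apply: wp_weaken (_ : wpI _ 0 _ _) (leq0n _) _; last by move=> M'; exact: id.
  apply: wp_skip; rewrite best5; split=> //.
    by case: iM => l s bd; split; rewrite ?best5 ?a65.
  case: range => [ok|[j jm hj]].
    by right; have [hs _ _] := hok ok; rewrite -sE -hs.
  left; exists j => //; have [e4 _] := h4 j jm; move: hj; rewrite e4.
  by move: W0; move: (numq _) W; clear; lia.
- have : (y <= y ^ 2)%N by rewrite -mulnn leq_pmulr // (leq_trans _ y3).
  by move: my y3; move: (y ^ 2)%N (y) (m); clear; lia.
Qed.

Lemma wp_search M : ready M -> incumbent M ->
  wpI search (y * (2 ^ E * (50 * y ^ 2))) (fun M' =>
    [/\ incumbent M', mr M' rBest <= mr M rBest &
        forall k c, 2 ^+ k < 2 * W + 2 -> (c < 2 ^ E)%N ->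
          covered (2 ^+ k) c (mr M' rBest)]) M.
Proof.
move=> rM iM; have W0 := W_ge0; have Sy := S_le_y.
apply: wp_weaken (_ : wpI _ (1 + ((6 * S + 1) *
  ((2 ^ E * (40 * y ^ 2).+2 + 2) + 1).+1 + 1))%N _ M) _ _; last 1 first.
- by move=> M' h; exact: h.
- apply: wp_seq; apply: wp_set_reg => //=; set M1 := setr _ _ _.
  have rM1 : ready M1 by case: rM => *; split.
  have iM1 : incumbent M1 by case: iM => *; split.
  apply: (@wp_while _ _ _ _ _ _ y3 (6 * S + 1) _ (fun k M' =>
    [/\ mr M' rG = 2 ^+ k, incumbent M', mr M' rBest <= mr M rBest &
      forall k' c, (k' < k)%N -> (c < 2 ^ E)%N -> covered (2 ^+ k') c (mr M' rBest)])) => //=.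
  + move=> k M' fM [hg iM' hb hcov].
    have rM' : ready M' by exact: ready_frame fM isT isT rM1.
    rewrite (ready_W rM') hg => lt.
    have kN : (k < 6 * S + 1)%N.
      have h : 2 ^+ k < 2 ^+ (6 * S + 1) :> int.
        apply: lt_le_trans lt _; rewrite exprD expr1.
        have -> : 2 ^+ (6 * S) = (2 ^ (6 * S))%N%:Z by rewrite -natz natrX.
        by move: W_lt W0; move: W (2 ^ _)%N; clear; lia.
      by move: h; rewrite ltr_eXn2l.
    split=> //; apply: wp_seq; apply: wp_frame.
    have ES : (2 ^ E < 2 ^ y)%N.
      by rewrite ltn_exp2l //; apply: leq_ltn_trans E_le_S _; move: Sy S0; clear; lia.
    apply: (@wp_for _ _ _ _ _ _ y3 (2 ^ E) (40 * y ^ 2) (fun c M'' =>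
      [/\ incumbent M'', mr M'' rBest <= mr M' rBest &
        forall c', (c' < c)%N -> covered (2 ^+ k) c' (mr M'' rBest)])) => //=.
    * move=> M'' fM''; have rM'' : ready M'' by exact: ready_frame fM'' isT isT rM'.
      by rewrite (ready_codes rM'') -natz natrX.
    * by move=> c M'' v [[? ? ?] ? ?]; split.
    * move=> c M'' fM'' cE hc [iM'' hb'' hcov''].
      have rM'' : ready M'' by exact: ready_frame fM'' isT isT rM'.
      have hg'' : mr M'' rG = 2 ^+ k by have [fr _] := fM''; rewrite fr.
      apply: wp_weaken (wp_try_code rM'' iM'' hc cE hg'' _ _) (leqnn _) _.
      - by rewrite exprn_ge0.
      - by rewrite abszX ltn_exp2l //; move: kN S0; clear; lia.
      move=> M2 [iM2 hb2 hcov2]; split=> //; first exact: le_trans hb''.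
      move=> c'; rewrite ltnS leq_eqVlt => /predU1P[->//|c'c].
      by apply: covered_le hb2 _; exact: hcov''.
    move=> M2 fM2 [iM2 hb2 hcov2] _.
    have hg2 : mr M2 rG = 2 ^+ k by have [fr _] := fM2; rewrite fr.
    apply: wp_set_reg => //=; rewrite hg2 exp2_double.
      by apply: small_pow2; move: kN Sy S0; clear; lia.
    split=> //.
    * by case: iM2 => *; split.
    * exact: le_trans hb2 hb.
    move=> k' c; rewrite ltnS leq_eqVlt => /predU1P[->|k'k] cE; first exact: hcov2.
    by apply: covered_le hb2 _; exact: hcov.
  move=> k M' fM [hg iM' hb hcov].
  have rM' : ready M' by exact: ready_frame fM isT isT rM1.
  rewrite (ready_W rM') hg => ge; split=> // k' c lt cE.
  by apply: hcov => //; have := lt_le_trans lt ge; rewrite ltr_eXn2l.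
- have : (0 < 2 ^ E)%N by rewrite expn_gt0.
  have : (9 <= y ^ 2)%N by rewrite -[9%N]/(3 ^ 2)%N leq_exp2r // y3.
  move: Sy S0; move: (S) (y) (y ^ 2)%N (2 ^ E)%N => s k z X; clear => h1 h2 h3 h4.
  have : ((6 * s + 1) * ((X * (40 * z).+2 + 2) + 1).+1 <= (6 * s + 1) * (X * (45 * z)))%N.
    by rewrite leq_mul2l; apply/orP; right; nia.
  have : ((6 * s + 1) * (X * (45 * z)) <= (k - 1) * (X * (45 * z)))%N.
    by rewrite leq_mul2r; apply/orP; right; lia.
  have : (X * (45 * z) <= X * (50 * z))%N by rewrite leq_mul2l; apply/orP; right; lia.
  have : (2 <= X * (45 * z))%N by nia.
  by move: (X * (45 * z))%N (X * (50 * z))%N => u v; nia.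
Qed.

Lemma wp_output M : ready M ->
  wpI output (10 * y) (fun M' => forall j, (j < m)%N -> ma M' 4 j = ma M 6 j /\ ma M' 5 j = D) M.
Proof.
move=> rM; have my := m_le_y.
apply: wp_weaken (_ : wpI _ (m * (1 + 1).+2 + 2) _ M) _ _; last 1 first.
- by move=> M' h; exact: h.
- apply: (@wp_for _ _ _ _ _ _ y3 m (1 + 1) (fun k M' =>
    forall j, (j < k)%N -> ma M' 4 j = ma M 6 j /\ ma M' 5 j = D)) => //=.
  + exact: lt_m_exp.
  + by move=> M' [fr _]; rewrite fr // (ready_m rM).
  + move=> k M' fM km hk hj; have [fr fa] := fM.
    have rM' : ready M' by exact: ready_frame fM isT isT rM.
    apply: wp_safe => -[_ sa _].
    apply: wp_seq; apply: wp_set_arr => //=; first exact: sa.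
    apply: wp_set_arr => //=; rewrite (ready_D rM') ?hk /=; first exact: small_D.
    move=> j; rewrite ltnS leq_eqVlt => /predU1P[->|jk]; first by rewrite !eqxx fa.
    by rewrite ltn_eqF //; exact: hj.
- by move: my y3; clear; lia.
Qed.

Definition initial : memory := Memory (regs (Defs.init I w)) (arrs (Defs.init I w)) [::].

Lemma entry_out n' m' (A : 'M[rat]_(n', m')) i j : ~~ ((i < n') && (j < m'))%N -> entry A i j = 0.
Proof.
rewrite /entry negb_and => /orP[] h; first by rewrite insubN.
by case: (insub i) => // ?; rewrite insubN.
Qed.

Lemma bitlen_size x : (bitlen x <= size_of I)%N -> smallI x.
Proof.
move=> h; apply: leq_trans (ltn_exp_bitlen _) _; rewrite leq_exp2l //.
by apply: leq_trans h _; have := S_le_y; rewrite /S; lia.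
Qed.

Lemma bas_small k : smallI (numq (bas k)) /\ smallI (denq (bas k)).
Proof.
case: (ltnP k (n * m)) => km.
  have : (bitlen (numq (bas k)) + bitlen (denq (bas k)) <= size_of I)%N.
    by rewrite size_ofE (bigD1 (Ordinal km)) //= -addnA leq_addr.
  by move=> h; split; apply: bitlen_size; apply: leq_trans h; rewrite ?leq_addr ?leq_addl.
rewrite /bas entry_out ?numq0 ?denq0 //.
apply/negP => /andP[h1 h2].
by have := mixed_radix_ltn h1 h2; rewrite -divn_eq ltnNge km.
Qed.

Lemma tgt_small k : smallI (numq (tgt k)) /\ smallI (denq (tgt k)).
Proof.
case: (ltnP k m) => km.
  have : (bitlen (numq (tgt k)) + bitlen (denq (tgt k)) <= size_of I)%N.
    by rewrite size_ofE [X in (_ <= _ + X)%N](bigD1 (Ordinal km)) //= addnCA leq_addr.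
  by move=> h; split; apply: bitlen_size; apply: leq_trans h; rewrite ?leq_addr ?leq_addl.
by rewrite /tgt entry_out ?numq0 ?denq0 // -leqNgt km.
Qed.

Lemma safe_initial : safe y same_shape initial.
Proof.
split=> //=.
- move=> x; case: eqP => _; first by apply: small_nat; apply: leq_trans rk_le m_le_y.
  by case: eqP => _ //; apply: small_nat; exact: m_le_y.
- move=> i k _; have [b1 b2] := bas_small k; have [t1 t2] := tgt_small k.
  by do 4 (case: eqP => _ //).
Qed.

Lemma wp_reduction : wpI reduction (y * (2 ^ E * (100 * y ^ 2))) (fun M' =>
    exists best : nat -> int,
    [/\ in_lattice (Defs.basis I) (\row_j ((best j)%:~R / D%:~R)),
        score p m (fun j => best j - T j) <= score p m (fun j => - T j),
        forall k c, 2 ^+ k < 2 * W + 2 -> (c < 2 ^ E)%N ->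
          covered (2 ^+ k) c (score p m (fun j => best j - T j))
      & forall j, (j < m)%N -> ma M' 4 j = best j /\ ma M' 5 j = D]) initial.
Proof.
have W0 := W_ge0.
apply: wp_weaken (_ : wpI _ (10 * y + (10 * y + (10 * y + (20 * y ^ 2 + (1 +
  (y * (2 ^ E * (50 * y ^ 2)) + 10 * y))))))%N _ _) _ _; last 1 first.
- by move=> M' h; exact: h.
- apply: wp_seq; apply: wp_frame.
  apply: wp_weaken (wp_common_denominator _ _ _ _) (leqnn _) _ => //=.
  move=> M1 hD [fr1 fa1].
  apply: wp_seq; apply: wp_frame.
  apply: wp_weaken (wp_rescale_target _ _ _ _ _) (leqnn _) _ => //=.
  + by rewrite fr1.
  + by rewrite fr1.
  + by move=> k; rewrite fa1.
  + by move=> k; rewrite fa1.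
  move=> M2 [hW hT] [fr2 fa2].
  apply: wp_seq; apply: wp_frame.
  apply: wp_weaken (wp_count_codes _) (leqnn _) _ => //=; first by rewrite fr2 // fr1.
  move=> M3 [hC hB] [fr3 fa3].
  have rM3 : ready M3.
    split=> //.
    * by rewrite fr3 // fr2 // fr1.
    * by rewrite fr3 // fr2 // fr1.
    * by rewrite fr3 // fr2.
    * by rewrite fr3.
    * by move=> k; rewrite fa3 // fa2 // fa1.
    * by move=> k; rewrite fa3 // fa2 // fa1.
    * by move=> j jm; rewrite fa3 // hT.
  have best3 : mr M3 rBest = 0 by rewrite fr3 // fr2 // fr1.
  have z3 a' j : a' \in [:: 4; 5; 6]%N -> ma M3 a' j = 0.
    by rewrite !inE => /or3P[] /eqP ->; rewrite fa3 // fa2 // fa1.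
  have hb3 : 0 <= mr M3 rBest <= m%:Z * B0.
    by rewrite best3 lexx mulr_ge0 // (le_trans ler01 B0_ge1).
  apply: wp_seq; apply: wp_frame; apply: wp_weaken (wp_score_answer rM3 hb3) (leqnn _) _ => //.
  move=> M4 [s4 hok _] fM4; have rM4 : ready M4 by exact: ready_frame fM4 isT isT rM3.
  have [fr4 fa4] := fM4.
  have [|hs hsB _] := hok; first by move=> j _; rewrite z3.
  have sE : mr M4 rScore = score p m (fun j => - T j).
    by rewrite hs; apply: eq_score => j _; rewrite !z3 // mul0r div0z sub0r.
  have small_s : smallI (mr M4 rScore).
    apply: (small_score hb3 s4); apply: le_trans hsB _.
    apply: ler_pM => //; [exact: le_trans B0_ge1|rewrite lez_nat //|].
    by rewrite -addrA lerDl addr_ge0 //; have /andP[] := hb3.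
  apply: wp_seq; apply: wp_set_reg => //=; set M5 := setr _ _ _.
  have rM5 : ready M5 by case: rM4 => *; split.
  have z6 j : ma M4 6 j = 0 by rewrite fa4 // z3.
  have iM5 : incumbent M5.
    split=> /=; last by rewrite s4.
      rewrite (_ : \row_j _ = 0); first exact: in_lattice0.
      by apply/rowP => j; rewrite !mxE z6 mul0r.
    by rewrite sE; apply: eq_score => j _; rewrite z6 sub0r.
  apply: wp_seq; apply: wp_frame; apply: wp_weaken (wp_search rM5 iM5) (leqnn _) _ => //.
  move=> M6 [[i1 i2 i3] hb6 cov6] fM6; have rM6 : ready M6 by exact: ready_frame fM6 isT isT rM5.
  apply: wp_weaken (wp_output rM6) (leqnn _) _ => //.
  move=> M7 h7; exists (ma M6 6); rewrite -i2; split=> //.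
  by rewrite -sE; exact: hb6.
- have : (0 < 2 ^ E)%N by rewrite expn_gt0.
  move: y3; move: (2 ^ E)%N (y); clear => X k k3 X0.
  have h : (k * (1 * (50 * k ^ 2)) <= k * (X * (50 * k ^ 2)))%N.
    by rewrite leq_mul2l leq_mul2r X0 !orbT.
  have : (X * (100 * k ^ 2) = X * (50 * k ^ 2) + X * (50 * k ^ 2))%N by lia.
  move=> ->; rewrite mulnDr; move: (k * (X * _))%N h => v h.
  by nia.
Qed.
End Verification.

Lemma step_count_eq (x k : nat) :
  (k * (x * (100 * k ^ 2)) * kap k = x * (10 * k) ^ 6)%N.
Proof. by rewrite /kap !expnS !expn0; lia. Qed.

Lemma step_count_le (a s c x : nat) (k := ((8 * a + 100) * s)%N) :
  (0 < s)%N -> c = ((20 * (8 * a + 100)) ^ 6)%N ->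
  (4 * (x * (10 * k) ^ 6) <= x * (c * s ^ c))%N.
Proof.
move=> s0 hc; have c6 : (6 <= c)%N.
  rewrite hc; apply: leq_trans (ltnW (ltn_expl 6 (_ : 1 < 20 * (8 * a + 100))%N)) _ => //.
  by lia.
rewrite mulnCA leq_mul2l; apply/orP; right.
apply: (@leq_trans (c * s ^ 6)); last by rewrite leq_mul2l leq_pexp2l // orbT.
rewrite hc -expnMn; apply: (@leq_trans (2 ^ 6 * (10 * k) ^ 6)); first by rewrite leq_mul2r orbT.
by rewrite -expnMn leq_exp2r // /k; lia.
Qed.

Unset Implicit Arguments.
Set Strict Implicit.

Theorem theorem4p7 (R : realType) (p : R) (q : \bar R)
    (eps gamma : nat -> nat -> R)
    (heps : forall n m, 0 < eps n m < 1 / 100)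
    (hp : 1 <= p) (hpq : (p%:E < q)%E)
    (hgamma : forall n m, 1 <= gamma n m) :
  let gamma' := fun n m : nat =>
    100 * log2 (1 / eps n m) `^ p^-1 / eps n m `^ p^-1 * gamma n m in
  exists (P : cmd) (c : nat),
    dim_rank_preserving_reduction (parameters p q eps gamma)
      (time_bound eps c) (CVP gamma' p%:E) (CVP gamma q) P.
Proof.
move=> gamma'; pose a := (Num.truncn p).+1.
have pa : p <= a%:R by apply: ltW; exact: truncnS_gt.
have [c hc] : exists c, c = ((20 * (8 * a + 100)) ^ 6)%N by exists ((20 * (8 * a + 100)) ^ 6)%N.
exists reduction, c => O hO I vI; exists 0%N.
set theta := parameters p q eps gamma I.
have he := heps (rk I) (dm I).
set e := eps (rk I) (dm I) in he.
have cvp g x : @CVP R gamma q (nearby I e g x) (answer_row O I e g x) by exact: hO.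
have lat g x : in_lattice (Defs.basis I) (answer_row O I e g x).
  by have [/lattice_ratr] := cvp g x.
have run (w : 0.-tuple bool) := @wp_reduction R theta O w I p e a erefl erefl hp pa he vI lat
  (safe_initial w hp pa he vI) 0%N.
split=> [w|].
  have [M [t [ex tk [_ _ sq] _]]] := run w.
  exists (st w M t); split; [exact: ex| |exact: sq].
  rewrite /= /time_bound -/e; move: tk; rewrite add0n step_count_eq.
  have /andP[_] := E_bounds I he; set E := (_ + 2)%N => hE tk.
  have h2 : (2 ^ E)%:R <= 4 * 2 `^ (e * (dm I)%:R) :> R.
    rewrite natrX -powR_mulrn //.
    have -> : 4 = 2 `^ 2 :> R by rewrite (powR_mulrn 2) //; lra.
    by rewrite -powRD ?pnatr_eq0 ?implybT //; apply: ler_powR; lra.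
  apply: le_trans (_ : (2 ^ E * (10 * ((8 * a + 100) * (size_of I).+1)) ^ 6)%:R <= _).
    by rewrite ler_nat.
  rewrite natrM; apply: le_trans (ler_wpM2r (ler0n _ _) h2) _.
  rewrite mulrAC -natrM mulrC ler_wpM2l ?powR_ge0 // ler_nat.
  by have := @step_count_le _ _ _ 1 (ltn0Sn (size_of I)) hc; rewrite !mul1n.
have -> : #|[pred w : 0.-tuple bool |
    `[< exists s, exec theta O reduction (Defs.init I w) s /\
          @CVP R gamma' p%:E I (mem_output s (dm I)) >] ]| = (2 ^ 0)%N.
  rewrite -[2%N]card_bool -card_tuple; apply: eq_card => w; rewrite !inE.
  apply/asboolP; have [M [t [ex _ _ [best [b1 b2 b3 b4]]]]] := run w.
  exists (st w M t); split; first exact: ex.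
  have -> : mem_output (st w M t) (dm I) =
      \row_j ((best j)%:~R / (den_target I (dm I))%:~R).
    by apply/rowP => j; rewrite !mxE /Defs.frac /=; have [-> ->] := b4 j (ltn_ord j).
  split; first exact/lattice_ratr.
  have /andP[hE _] := E_bounds I he.
  apply: (approximation hp hpq he (hgamma _ _) hE (E_gt0 _ _) (D_gt0 I)
    (@D_basis I) (@D_target I) erefl b2) => k x hk hx.
  exists (answer_row O I e (2 ^+ k) x).
  by split; [exact: lat|have [] := cvp (2 ^+ k) x|exact: b3].
by rewrite expn0 expr0 divr1; lra.
Qed.
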